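(* Let $\mathcal{C}$ be the circle in $\mathbb{C}_p$ with center $a$ and radius $R>0$. Let $\mathcal{D} = D^{+}(a,R)\setminus \bigcup_{i = 1}^{M}D^{-}(x_{i},r_{i})$ ($M\ge 1$) with $0<r_{i} < R$ and the discs $D^{+}(x_{i},r_{i})$ mutually disjoint. Let $b$ be a point on $\mathcal{C}$ with $|b - x_{i}|_{p} = R$ for all $i$. For $i = 1, \dots, M$ choose $b_{i}$ so that $|x_{i} - b_{i}|_{p} = r_{i}$. Let $x_{0} \in \mathcal{D}$ be such that $|x_{0} - x_{i}|_{p} > r_{i}$ for $1\le i\le M$ and $|x_{0} - b|_{p} = R$. Let $r^{*} = \min_{1 \leq i \leq M}|x_{0} - x_{i}|_{p}$ and $\mathcal{D}^{*} = D^{-}(x_{0}, r^{*})$. Let $\alpha \in \mathbb{Z}_{\geq 0}$. Then, if $z \in \mathcal{D}^{*}$ and $f$ is a Krasner analytic function on $\mathcal{D}$, $$\frac{f(z)}{1 - \omega\left( \frac{a - x_{0}}{a - b}\right)^{p^{\alpha}}} = \int_{\mathcal{A}(a,b),\Phi_{\alpha}}\frac{f(x)}{x - z}\,dx - \sum_{i = 1}^{M}\frac{1}{1 - \omega\left( \frac{a - x_{i}}{a - b}\right)^{p^{\alpha}}}\int_{\mathcal{A}(x_{i},b_{i}),\Phi_{\alpha}}\frac{f(x)}{x - z}\,dx,$$ all the integrals existing. (In particular the constant coefficients depend only on $\alpha$, the arc $\mathcal{A}(a,b)$, $\mathcal{D}^{*}$, $\mathcal{D}$ and the choice of boundary circle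 $\mathcal{C}$.)
   Context: $p$ is an odd prime; $\mathbb{C}_p$ is the completion of an algebraic closure of $\mathbb{Q}_p$, with $|p|_p=1/p$. $D^+(c,r)$ and $D^-(c,r)$ are the closed and open discs with center $c$ and radius $r$. Arc: for $a\ne b$ in $\mathbb{C}_p$ with $R=|a-b|_p$, the arc $\mathcal{A}(a,b)$ is the open disc $\{x : |x-b|_p<R\}$. Path sequence: a function $\varphi$ defined for all integers $k\ge k_0$ (some $k_0\in\mathbb{Z}^+$), with values in $\mathbb{Z}^+$ and strictly increasing. For $f:\mathcal{A}(a,b)\to\mathbb{C}_p$ put $A_{f,\varphi}(k)=p^{-\varphi(k)}\sum_{\zeta}(x-a)f(x)$, where $x=a+(b-a)\zeta$ and $\zeta$ runs through the $p^{\varphi(k)}$-th roots of unity. A non-empty family $\Phi$ of path sequences is interlocked if for all $\varphi_1,\varphi_2\in\Phi$ there are $\varphi_3\in\Phi$ and $k_0$ such that $\varphi_3(k)$, $k\ge k_0$, is a subsequence of both $\varphi_1$ and $\varphi_2$. For interlocked $\Phi$, $\int_{\mathcal{A}(a,b),\Phi}f(x)\,dx=L$ means: for every $\varepsilon>0$ there are $\varphi_\varepsilon\in\Phi$ and $K_\varepsilon$ with $|A_{f,\varphi_\varepsilon}(k)-L|_p<\varepsilon$ for all $k>K_\varepsilon$ (such $L$ is unique if it exists). For $\alpha\in\mathbb{Z}$, $\Phi_\alpha$ is the interlocked family $\{\varphi : \varphi(k)=\alpha+\lambda k,\ \lambda=1,2,\dots\}$. $\omega$ is the Teichmüller character: for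 $|x|_p=1$, $\omega(x)$ is the unique root of unity of order prime to $p$ with $|x-\omega(x)|_p<1$; $\omega(x)=0$ if $|x|_p<1$. A function on $\mathcal{D}$ (a closed disc with finitely many open discs removed) is Krasner analytic if it is the uniform limit on $\mathcal{D}$ of rational functions whose poles are outside $\mathcal{D}$. *)

(* Defs.v *)
From HB Require Import structures.
From mathcomp Require Import all_boot all_order all_algebra.
From mathcomp Require Import all_classical all_reals.
From mathcomp Require Import zify.

Set Implicit Arguments.
Unset Strict Implicit.
Unset Printing Implicit Defensive.

Import Order.TTheory GRing.Theory Num.Theory.
Local Open Scope classical_set_scope.
Local Open Scope ring_scope.

HB.mixin Record Field_isValued (R : realType) K of GRing.Field K := {
  vabs : K -> R;
  vabs_ge0 : forall x, 0 <= vabs x;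
  vabs_eq0 : forall x, vabs x = 0 -> x = 0;
  vabs0 : vabs 0 = 0;
  vabsM : forall x y, vabs (x * y) = vabs x * vabs y;
  vabs_ultra : forall x y, vabs (x + y) <= Num.max (vabs x) (vabs y)
}.

#[short(type="valuedFieldType")]
HB.structure Definition ValuedField (R : realType) :=
  {K of GRing.Field K & Field_isValued R K}.

Section PadicComplex.
Context {R : realType}.

Definition vcomplete (K : valuedFieldType R) : Prop :=
  forall u : nat -> K,
    (forall e : R, 0 < e -> exists N, forall m n, (N <= m)%N -> (N <= n)%N ->
       vabs (u m - u n) < e) ->
    exists l : K, forall e : R, 0 < e -> exists N, forall n, (N <= n)%N ->
       vabs (u n - l) < e.

Definition is_completion (F : fieldType) (absF : F -> R)
    (K : valuedFieldType R) : Prop :=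
  vcomplete K /\
  exists i : {rmorphism F -> K},
    (forall x, vabs (i x) = absF x) /\
    (forall (y : K) (e : R), 0 < e -> exists x, vabs (y - i x) < e).

(* L is an algebraic closure of K whose absolute value extends that of K. *)
Definition is_valued_algebraic_closure (K L : valuedFieldType R) : Prop :=
  GRing.closed_field_axiom L /\
  exists i : {rmorphism K -> L},
    (forall x, vabs (i x) = vabs x) /\ (forall y : L, algebraicOver i y).

Definition padic_abs (p : nat) (q : rat) : R :=
  if q == 0 then 0
  else p%:R ^+ logn p `|denq q|%N / p%:R ^+ logn p `|numq q|%N.

(* The field C_p is only determined up to isometric isomorphism; this says that
   C is one of its models: Q --> Q_p --> algebraic closure --> completion. *)
Definition is_padic_complex (p : nat) (C : valuedFieldType R) : Prop :=
  exists Qp Qpbar : valuedFieldType R,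
    [/\ is_completion (padic_abs p) Qp,
        is_valued_algebraic_closure Qp Qpbar
      & is_completion (vabs : Qpbar -> R) C].

End PadicComplex.

(* Only the values of pfun at k >= pstart are meaningful. *)
Record path_seq := PathSeq {
  pstart : nat;
  pfun :> nat -> nat;
  pstart_gt0 : (0 < pstart)%N;
  pfun_gt0 : forall k, (pstart <= k)%N -> (0 < pfun k)%N;
  pfun_incr : forall k l, (pstart <= k)%N -> (k < l)%N -> (pfun k < pfun l)%N
}.

Definition subseq_from (k0 : nat) (phi3 phi : path_seq) : Prop :=
  exists s : nat -> nat,
    (forall k l, (k0 <= k)%N -> (k < l)%N -> (s k < s l)%N) /\
    (forall k, (k0 <= k)%N -> (pstart phi <= s k)%N /\ phi3 k = phi (s k)).

Record interlocked_family := InterlockedFamily {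
  members : set path_seq;
  members_neq0 : members !=set0;
  members_interlocked : forall phi1 phi2, members phi1 -> members phi2 ->
    exists phi3 k0, [/\ members phi3, (pstart phi3 <= k0)%N,
      subseq_from k0 phi3 phi1 & subseq_from k0 phi3 phi2]
}.

(* The starting index of a member is free: any one at which the values
   alpha + lambda * k are positive. *)
Definition Phi_set (alpha : int) : set path_seq :=
  [set phi | exists2 lambda : nat, (0 < lambda)%N &
     forall k, (pstart phi <= k)%N ->
       (phi k)%:Z = alpha + lambda%:Z * k%:Z].

Lemma Phi_set_ex (alpha : int) (lambda k1 : nat) : (0 < lambda)%N ->
  exists phi : path_seq, (k1 <= pstart phi)%N /\
    forall k, (pstart phi <= k)%N -> (phi k)%:Z = alpha + lambda%:Z * k%:Z.
Proof.
move=> l0; pose k0 := (k1 + `|alpha|)%N.+1.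
have val k : (k0 <= k)%N ->
    (`|(alpha + lambda%:Z * k%:Z)%R|%N)%:Z = alpha + lambda%:Z * k%:Z.
  rewrite /k0 => hk; apply: gez0_abs; nia.
have pos k : (k0 <= k)%N -> (0 < `|(alpha + lambda%:Z * k%:Z)%R|)%N.
  rewrite /k0 => hk; have := val _ hk; nia.
have inc k l : (k0 <= k)%N -> (k < l)%N ->
    (`|(alpha + lambda%:Z * k%:Z)%R| < `|(alpha + lambda%:Z * l%:Z)%R|)%N.
  move=> hk kl; have := val _ hk; have := val l (leq_trans hk (ltnW kl)); nia.
exists (@PathSeq k0 (fun k => `|(alpha + lambda%:Z * k%:Z)%R|%N) isT pos inc).
by split => //=; rewrite /k0; lia.
Qed.

Lemma Phi_set_neq0 (alpha : int) : Phi_set alpha !=set0.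
Proof.
have [phi [_ hphi]] := @Phi_set_ex alpha 1%N 0%N isT.
by exists phi; exists 1%N.
Qed.

Lemma Phi_set_interlocked (alpha : int) phi1 phi2 :
  Phi_set alpha phi1 -> Phi_set alpha phi2 ->
  exists phi3 k0, [/\ Phi_set alpha phi3, (pstart phi3 <= k0)%N,
    subseq_from k0 phi3 phi1 & subseq_from k0 phi3 phi2].
Proof.
move=> [l1 l1p h1] [l2 l2p h2].
have l12 : (0 < l1 * l2)%N by rewrite muln_gt0 l1p.
have [phi3 [hs h3]] := Phi_set_ex alpha (pstart phi1 + pstart phi2) l12.
exists phi3, (pstart phi3); split => //; first by exists (l1 * l2)%N.
- exists (fun k => l2 * k)%N; split => [k l _ kl|k hk].
    by rewrite ltn_pmul2l.
  have hk1 : (pstart phi1 <= l2 * k)%N by nia.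
  split => //; have := h3 _ hk; have := h1 _ hk1; lia.
- exists (fun k => l1 * k)%N; split => [k l _ kl|k hk].
    by rewrite ltn_pmul2l.
  have hk2 : (pstart phi2 <= l1 * k)%N by nia.
  split => //; have := h3 _ hk; have := h2 _ hk2; lia.
Qed.

Definition Phi (alpha : int) : interlocked_family :=
  InterlockedFamily (Phi_set_neq0 alpha) (@Phi_set_interlocked alpha).

Section Integral.
Context {R : realType} {C : valuedFieldType R}.
Implicit Types (a b c : C) (r : R) (f : C -> C).

Definition Dplus c r : set C := [set x | vabs (x - c) <= r].
Definition Dminus c r : set C := [set x | vabs (x - c) < r].
Definition circle c r : set C := [set x | vabs (x - c) = r].
Definition padic_arc a b : set C := Dminus b (vabs (a - b)).

(* Functions on a subset of C are total functions of which only the values on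
   that subset are used; the points below lie in the arc when n is a power
   of p. *)
Definition root_mean (n : nat) a b f : C :=
  n%:R^-1 * \sum_(zeta \in [set zeta : C | zeta ^+ n = 1])
    (a + (b - a) * zeta - a) * f (a + (b - a) * zeta).

Definition path_mean (p : nat) a b f (phi : path_seq) (k : nat) : C :=
  root_mean (p ^ phi k)%N a b f.

Definition is_path_integral (p : nat) a b (Fam : interlocked_family) f
    (L : C) : Prop :=
  forall e : R, 0 < e ->
    exists phi K, members Fam phi /\
      forall k, (pstart phi <= k)%N -> (K < k)%N ->
        vabs (path_mean p a b f phi k - L) < e.

Definition path_integrable (p : nat) a b (Fam : interlocked_family) f : Prop :=
  exists L, is_path_integral p a b Fam f L.

Definition path_integral (p : nat) a b (Fam : interlocked_family) f : C :=
  xget 0 [set L | is_path_integral p a b Fam f L].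

(* Meaningful for vabs x <= 1 only. *)
Definition omega (p : nat) (x : C) : C :=
  if vabs x == 1 then
    xget 0 [set w : C | (exists2 n : nat, coprime n p & n.-primitive_root w) /\
                        vabs (x - w) < 1]
  else 0.

(* In lowest terms the poles of P/Q are the zeros of Q, so a rational function
   has no pole in D iff it is P/Q with Q free of zeros in D. *)
Definition krasner_analytic (D : set C) f : Prop :=
  exists P Q : nat -> {poly C},
    (forall n x, D x -> (Q n).[x] != 0) /\
    (forall e : R, 0 < e -> exists N, forall n, (N <= n)%N ->
       forall x, D x -> vabs (f x - (P n).[x] / (Q n).[x]) < e).

End Integral.

(* The holes are indexed from 0: hole i has centre hx i and radius hr i, and
   hb i lies on its bounding circle. *)
Record cauchy_data (R : realType) (C : valuedFieldType R) := CauchyData {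
  ctr : C;
  rad : R;
  rad_gt0 : 0 < rad;
  nholes : nat;
  nholes_gt0 : (0 < nholes)%N;
  hx : 'I_nholes -> C;
  hr : 'I_nholes -> R;
  hr_gt0 : forall i, 0 < hr i;
  hr_lt : forall i, hr i < rad;
  holes_disjoint : forall i j, i != j ->
    Dplus (hx i) (hr i) `&` Dplus (hx j) (hr j) = set0;
  bpt : C;
  bpt_circle : circle ctr rad bpt;
  bpt_holes : forall i, vabs (bpt - hx i) = rad;
  hb : 'I_nholes -> C;
  hb_hx : forall i, vabs (hx i - hb i) = hr i;
  base : C;
  base_in : (Dplus ctr rad `\` \bigcup_i Dminus (hx i) (hr i)) base;
  base_holes : forall i, hr i < vabs (base - hx i);
  base_bpt : vabs (base - bpt) = rad
}.

Arguments hx {R C} c i.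
Arguments hr {R C} c i.
Arguments hb {R C} c i.

Section CauchyData.
Context {R : realType} {C : valuedFieldType R}.
Implicit Type S : cauchy_data C.

Definition boundary S : set C := circle (ctr S) (rad S).

Definition hole S (i : 'I_(nholes S)) : set C := Dminus (hx S i) (hr S i).

Arguments hole : clear implicits.

Definition domain S : set C :=
  Dplus (ctr S) (rad S) `\` \bigcup_i hole S i.

(* The minimum over all i; the initial value is the term for i = 0. *)
Definition rstar S : R :=
  \big[Num.min/vabs (base S - hx S (Ordinal (nholes_gt0 S)))]_(i < nholes S)
    vabs (base S - hx S i).

Definition Dstar S : set C := Dminus (base S) (rstar S).

End CauchyData.

Arguments hole {R C} S i.

(* Main.v *)
(** A priori the mean over the [p^n]-th roots of unity may enlarge the sup norm
    by a factor [p^n].  It does not for the restriction to an arc of a rational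
    function [P/Q] without poles in the arc: in the coordinate where the arc is
    [D^-(1,1)], on roots of unity [1/(x-c)] agrees with the polynomial
    [sum_i c^(N-1-i) x^i / (1-c^N)], [N = p^n], whose coefficients are bounded by
    [1/|c-1|], and the mean of a polynomial is a sum of its coefficients.  Hence
    all the means in the formula pass to uniform limits on the domain, and it is
    enough to treat a dense class of functions.

    Such a class is formed by the sums of a polynomial and of simple fractions
    [e/(x-c)], [c] outside the domain, multiple poles being removed by moving
    them slightly.  After division by [x-z] everything reduces to
    [1/(x-w)], whose mean over an arc [A(a,b)] is exactly [1/(1-u^N)] with
    [u = (w-a)/(b-a)].  Along [N = p^(alpha + l k)] this tends to
    [1/(1 - omega(u)^(p^alpha))] when [|u| <= 1] and to [0] when [|u| > 1], as
    soon as the [p^l]-th power map fixes the finitely many Teichmueller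
    representatives involved; the weights in the formula are those for which
    the contributions of the poles in the holes cancel. *)
Require Import Defs.
From mathcomp Require Import all_boot all_order all_algebra.
From mathcomp Require Import all_classical all_reals.
From mathcomp Require Import cyclic separable ring lra zify.

Set Implicit Arguments.
Unset Strict Implicit.
Unset Printing Implicit Defensive.

Import Order.TTheory GRing.Theory Num.Theory.
Local Open Scope classical_set_scope.
Local Open Scope ring_scope.

(** * Valued fields *)

Lemma bernoulli_ge (R : realType) (x : R) n : 0 <= x -> 1 + n%:R * x <= (1 + x) ^+ n.
Proof.
move=> x0; elim: n => [|n IH]; first by rewrite expr0 mul0r addr0.
rewrite exprS -natr1; apply: (@le_trans _ _ ((1 + x) * (1 + n%:R * x))).
  by have := mulr_ge0 (ler0n R n) (mulr_ge0 x0 x0); lra.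
by rewrite ler_wpM2l // addr_ge0.
Qed.

(** Bernoulli's inequality for $q^{-1} = 1 + (q^{-1} - 1)$ makes $q^{-n}$ exceed $e^{-1}$. *)
Lemma expr_small (R : realType) (q e : R) : 0 <= q -> q < 1 -> 0 < e ->
  exists N, forall n, (N <= n)%N -> q ^+ n < e.
Proof.
move=> q0 q1 e0; have [->|qn0] := eqVneq q 0.
  by exists 1%N => -[//|n] _; rewrite expr0n.
have qp : 0 < q by rewrite lt_neqAle eq_sym qn0.
have xp : 0 < q^-1 - 1 by rewrite subr_gt0 invf_gt1.
exists (Num.bound (e^-1 / (q^-1 - 1))) => n hn.
have hb : e^-1 / (q^-1 - 1) < n%:R.
  apply: (lt_le_trans (archi_boundP _)); last by rewrite ler_nat.
  by rewrite divr_ge0 ?invr_ge0 ?(ltW e0) ?(ltW xp).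
have := bernoulli_ge n (ltW xp); rewrite [1 + (_ - 1)]addrC subrK exprVn => hB.
rewrite -(ltf_pV2 (x := e)) ?posrE ?exprn_gt0 //.
apply: lt_le_trans hB; rewrite ltr_pdivrMr // in hb; lra.
Qed.

Section ValuedField.
Context {R : realType} {K : valuedFieldType R}.
Implicit Types (x y z : K) (e : R).
Notation v := (@vabs R K).

Lemma vabs_neq0 x : x != 0 -> v x != 0.
Proof. by apply: contra_neq; exact: vabs_eq0. Qed.

Lemma vabs_gt0 x : x != 0 -> 0 < v x.
Proof. by move=> x0; rewrite lt_neqAle eq_sym vabs_neq0 //= vabs_ge0. Qed.

Lemma vabs1 : v 1 = 1.
Proof. by apply: (mulfI (vabs_neq0 (oner_neq0 K))); rewrite -vabsM !mulr1. Qed.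

Lemma vabsN x : v (- x) = v x.
Proof.
have h : v (-1) = 1.
  apply/eqP; rewrite -(@pexpr_eq1 _ (v (-1)) 2) ?vabs_ge0 //.
  by rewrite expr2 -vabsM mulrNN mulr1 vabs1.
by rewrite -mulN1r vabsM h mul1r.
Qed.

Lemma vabsC x y : v (x - y) = v (y - x).
Proof. by rewrite -vabsN opprB. Qed.

Lemma vabsX x n : v (x ^+ n) = v x ^+ n.
Proof. by elim: n => [|n IH]; rewrite ?expr0 ?vabs1 // !exprS vabsM IH. Qed.

Lemma vabsV x : v x^-1 = (v x)^-1.
Proof.
have [->|x0] := eqVneq x 0; first by rewrite !invr0 vabs0 invr0.
by apply: (mulfI (vabs_neq0 x0)); rewrite -vabsM !divff ?vabs1 ?vabs_neq0.
Qed.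

Lemma vabs_div x y : v (x / y) = v x / v y.
Proof. by rewrite vabsM vabsV. Qed.

Lemma vabs_prod I (r : seq I) (F : I -> K) :
  v (\prod_(i <- r) F i) = \prod_(i <- r) v (F i).
Proof. by elim/big_rec2: _ => [|i x y _ <-]; rewrite ?vabs1 ?vabsM. Qed.

Lemma vabsD_le x y e : v x <= e -> v y <= e -> v (x + y) <= e.
Proof. by move=> hx hy; rewrite (le_trans (vabs_ultra x y)) // ge_max hx. Qed.

Lemma vabsD_lt x y e : v x < e -> v y < e -> v (x + y) < e.
Proof. by move=> hx hy; rewrite (le_lt_trans (vabs_ultra x y)) // gt_max hx. Qed.

Lemma vabsB_le x y e : v x <= e -> v y <= e -> v (x - y) <= e.
Proof. by move=> hx hy; apply: vabsD_le; rewrite ?vabsN. Qed.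

Lemma vabsB_lt x y e : v x < e -> v y < e -> v (x - y) < e.
Proof. by move=> hx hy; apply: vabsD_lt; rewrite ?vabsN. Qed.

Lemma vdist_le y x z e : v (x - y) <= e -> v (y - z) <= e -> v (x - z) <= e.
Proof. by move=> hx hy; rewrite -(subrKA y); apply: vabsD_le. Qed.

Lemma vdist_lt y x z e : v (x - y) < e -> v (y - z) < e -> v (x - z) < e.
Proof. by move=> hx hy; rewrite -(subrKA y); apply: vabsD_lt. Qed.

Lemma vabs_sum_le I (r : seq I) (P : pred I) (F : I -> K) e : 0 <= e ->
  (forall i, P i -> v (F i) <= e) -> v (\sum_(i <- r | P i) F i) <= e.
Proof.
move=> e0 h; elim/big_ind: _ => //; first by rewrite vabs0.
by move=> x y; apply: vabsD_le.
Qed.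

Lemma vabs_sum_lt I (r : seq I) (P : pred I) (F : I -> K) e : 0 < e ->
  (forall i, P i -> v (F i) < e) -> v (\sum_(i <- r | P i) F i) < e.
Proof.
move=> e0 h; elim/big_ind: _ => //; first by rewrite vabs0.
by move=> x y; apply: vabsD_lt.
Qed.

Lemma vabsDr_eq x y : v y < v x -> v (x + y) = v x.
Proof.
move=> h; apply/eqP; rewrite eq_le vabsD_le // ?(ltW h) //= leNgt.
apply/negP => h'; have : v (x + y - y) < v x by apply: vabsB_lt.
by rewrite addrK ltxx.
Qed.

Lemma vabsDl_eq x y : v x < v y -> v (x + y) = v y.
Proof. by move=> h; rewrite addrC vabsDr_eq. Qed.

Lemma vabs_close x y : v (x - y) < v y -> v x = v y.
Proof. by move=> h; rewrite -[x in LHS](subrK y) vabsDl_eq. Qed.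

Lemma vdist_close x y z : v (x - y) < v (y - z) -> v (x - z) = v (y - z).
Proof. by move=> h; have := vabsDl_eq h; rewrite subrKA. Qed.

Lemma vabs_natr_le1 n : v n%:R <= 1.
Proof.
elim: n => [|n IH]; first by rewrite vabs0.
by rewrite -natr1 vabsD_le // vabs1.
Qed.

Lemma vabs_intr_le1 (m : int) : v m%:~R <= 1.
Proof. by case: m => n; rewrite ?NegzE ?mulrNz ?vabsN; exact: vabs_natr_le1. Qed.

Lemma vabs_eq0_le x : (forall e, 0 < e -> v x <= e) -> x = 0.
Proof.
move=> h; apply: vabs_eq0; apply/eqP; rewrite eq_le vabs_ge0 andbT leNgt.
apply/negP => h0; have := h (v x / 2); rewrite divr_gt0 // => /(_ isT).
lra.
Qed.

(** * Limits of sequences and passage to uniform limits *)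

Definition tends (u : nat -> K) (l : K) : Prop :=
  forall e, 0 < e -> exists N, forall n, (N <= n)%N -> v (u n - l) < e.

Lemma tends_ext u w l : (exists N, forall n, (N <= n)%N -> u n = w n) ->
  tends u l -> tends w l.
Proof.
move=> [N hN] h e e0; have [M hM] := h e e0.
exists (maxn N M) => n; rewrite geq_max => /andP[h1 h2].
by rewrite -hN // hM.
Qed.

Lemma tends_cst l : tends (fun=> l) l.
Proof. by move=> e e0; exists 0%N => n _; rewrite subrr vabs0. Qed.

Lemma tendsD u w l m : tends u l -> tends w m -> tends (fun n => u n + w n) (l + m).
Proof.
move=> hu hw e e0; have [N hN] := hu e e0; have [M hM] := hw e e0.
exists (maxn N M) => n; rewrite geq_max => /andP[h1 h2].
by rewrite opprD addrACA vabsD_lt ?hN ?hM.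
Qed.

Lemma tendsZ u l c : tends u l -> tends (fun n => c * u n) (c * l).
Proof.
move=> hu e e0; have c1 : 0 < v c + 1 by rewrite ltr_pwDr ?vabs_ge0.
have [N hN] := hu (e / (v c + 1)) (divr_gt0 e0 c1).
exists N => n /hN; rewrite ltr_pdivlMr // -mulrBr vabsM => h.
apply: le_lt_trans h; rewrite mulrC ler_wpM2l ?vabs_ge0 //; lra.
Qed.

Lemma tendsN u l : tends u l -> tends (fun n => - u n) (- l).
Proof.
move=> h; have := tendsZ (-1) h; rewrite mulN1r.
by apply: tends_ext; exists 0%N => n _; rewrite mulN1r.
Qed.

Lemma tendsB u w l m : tends u l -> tends w m -> tends (fun n => u n - w n) (l - m).
Proof. by move=> hu /tendsN hw; apply: tendsD. Qed.

(** If $|l - m| > e$, then [u n - w n] would eventually be so close to [l - m] as to have the same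
    absolute value. *)
Lemma tends_bound u w l m e : tends u l -> tends w m ->
  (forall n, v (u n - w n) <= e) -> v (l - m) <= e.
Proof.
move=> hu hw h; rewrite leNgt; apply/negP => he.
have [N /(_ N (leqnn _))] := tendsB hu hw (le_lt_trans (le_trans (vabs_ge0 _) (h 0%N)) he).
by move=> /vabs_close hh; move: (h N); rewrite hh leNgt he.
Qed.

Lemma tends_approx u : vcomplete K ->
  (forall e, 0 < e -> exists w l, tends w l /\ forall n, v (u n - w n) <= e) ->
  exists l, tends u l.
Proof.
move=> cK h; have [e e0|l hl] := cK u; last by exists l.
(* Halving [e] only turns the non-strict bound on [u n - w n] into a strict one; the ultrametric
   inequality itself costs no constant. *)
have e20 : 0 < e / 2 by rewrite divr_gt0.
have e2e : e / 2 < e by lra.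
have [w [l [hw huw]]] := h _ e20; have [N hN] := hw e e0.
exists N => m n hm hn; apply: (@vdist_lt (w m)).
  exact: le_lt_trans (huw m) e2e.
apply: (@vdist_lt l); first exact: hN.
apply: (@vdist_lt (w n)); rewrite vabsC; first exact: hN.
exact: le_lt_trans (huw n) e2e.
Qed.

(** * Bounds for values of polynomials *)

Lemma vabs_horner_le (P : {poly K}) x B e : v x <= B -> 1 <= B ->
  0 <= e -> (forall j, v P`_j <= e) -> v P.[x] <= e * B ^+ (size P).
Proof.
move=> hx B1 e0 hP; rewrite horner_coef; apply: vabs_sum_le => [|i _].
  by rewrite mulr_ge0 // exprn_ge0 // (le_trans ler01).
rewrite vabsM vabsX; apply: ler_pM; rewrite ?vabs_ge0 ?exprn_ge0 ?vabs_ge0 //.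
apply: (@le_trans _ _ (B ^+ i)); first by rewrite lerXn2r // nnegrE ?vabs_ge0 // (le_trans ler01).
by rewrite ler_weXn2l // ltnW.
Qed.

Lemma vabs_horner_lip (P : {poly K}) B : exists2 M, 0 < M &
  forall x y, v x <= B -> v y <= B -> v (P.[x] - P.[y]) <= M * v (x - y).
Proof.
elim/poly_ind: P => [|P c [M M0 IH]].
  by exists 1 => // x y _ _; rewrite !horner0 subrr vabs0 mulr_ge0 ?vabs_ge0.
(* For [P * 'X + c] the first entry handles the variation of [P] times [y], the second bounds [P] on
   the ball; [|B| + 1] is positive even if [B] is negative. *)
exists (Num.max (M * (`|B| + 1)) (\sum_(j < size P) v P`_j * (`|B| + 1) ^+ j)).
  by rewrite lt_max mulr_gt0 // ltr_pwDr.
move=> x y hx hy; rewrite !hornerE opprD addrACA subrr addr0.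
have hB : 0 <= `|B| + 1 by rewrite addr_ge0.
have hBB : B <= `|B| + 1 by rewrite (le_trans (ler_norm B)) // lerDl.
have -> : P.[x] * x - P.[y] * y = (P.[x] - P.[y]) * y + P.[x] * (x - y) by ring.
apply: vabsD_le; rewrite vabsM.
  apply: (@le_trans _ _ (M * v (x - y) * (`|B| + 1))).
    by rewrite ler_pM ?vabs_ge0 ?IH // (le_trans hy).
  by rewrite mulrAC ler_wpM2r ?vabs_ge0 // le_max lexx.
rewrite ler_wpM2r ?vabs_ge0 // le_max; apply/orP; right.
rewrite horner_coef; apply: vabs_sum_le => [|i _].
  by apply: sumr_ge0 => i _; rewrite mulr_ge0 ?vabs_ge0 ?exprn_ge0.
rewrite (bigD1 i) //= vabsM vabsX; apply: (@le_trans _ _ (v P`_i * (`|B| + 1) ^+ i)).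
  rewrite ler_wpM2l ?vabs_ge0 // lerXn2r // ?nnegrE ?vabs_ge0 //.
  exact: le_trans hx hBB.
by rewrite lerDl; apply: sumr_ge0 => j _; rewrite mulr_ge0 ?vabs_ge0 ?exprn_ge0.
Qed.

End ValuedField.

(** * The completion of an algebraically closed field is algebraically closed *)

Lemma closed_field_split (F : fieldType) : GRing.closed_field_axiom F ->
  forall P : {poly F}, exists rs, P = lead_coef P *: \prod_(c <- rs) ('X - c%:P).
Proof.
move=> ax P; move: {2}(size P) (erefl (size P)) => n.
elim: n P => [|n IH] P sP.
  by exists [::]; move/eqP: sP; rewrite size_poly_eq0 => /eqP ->; rewrite lead_coef0 scale0r.
case: n => [|n] in IH sP *.
  exists [::]; rewrite big_nil lead_coefE sP /= -mul_polyC mulr1.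
  by apply: size1_polyC; rewrite sP.
have P0 : P != 0 by rewrite -size_poly_eq0 sP.
have l0 : lead_coef P != 0 by rewrite lead_coef_eq0.
(* The axiom solves $x^{n+1} = \sum_i a_i x^i$, so the lower coefficients of [P] are divided by
   minus the leading one. *)
have [x hx] := ax n.+1 (fun i => - P`_i / lead_coef P) isT.
have /factor_theorem [Q PQ] : root P x.
  rewrite rootE horner_coef sP big_ord_recr /= hx mulr_sumr -big_split big1 //= => i _.
  have -> : P`_n.+1 = lead_coef P by rewrite lead_coefE sP.
  by rewrite mulrA mulrCA divff // mulr1 mulNr addrN.
have Q0 : Q != 0 by apply: contra_neq P0 => Q0; rewrite PQ Q0 mul0r.
have sQ : size Q = n.+1.
  by move: sP; rewrite PQ size_Mmonic ?monicXsubC // size_XsubC addnC => -[].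
have [rs hrs] := IH _ sQ; exists (x :: rs).
rewrite big_cons PQ lead_coef_Mmonic ?monicXsubC // {1}hrs.
by rewrite -scalerAl mulrC.
Qed.

Lemma prod_ge_expr (R : realDomainType) (I : eqType) (r : seq I) (F : I -> R) d :
  0 <= d -> (forall i, i \in r -> d <= F i) -> d ^+ size r <= \prod_(i <- r) F i.
Proof.
move=> d0; elim: r => [|a r IH] h; first by rewrite big_nil.
rewrite big_cons exprS ler_pM ?exprn_ge0 ?h ?mem_head // IH // => i ir.
by rewrite h // inE ir orbT.
Qed.

Section CompletionClosed.
Context {R : realType} {L K : valuedFieldType R}.
Notation v := (@vabs R K).

(** The sign follows [GRing.closed_field_axiom], whose equation is $x^n = \sum_{j<n} P_j x^j$. *)
Definition monic_of (F : nzRingType) n (P : nat -> F) : {poly F} :=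
  'X^n - \poly_(j < n) P j.

Lemma horner_monic_of (F : comNzRingType) n (P : nat -> F) x :
  (monic_of n P).[x] = x ^+ n - \sum_(j < n) P j * x ^+ j.
Proof. by rewrite !hornerE horner_poly. Qed.

Lemma monic_of_monic (F : nzRingType) n (P : nat -> F) : monic_of n P \is monic.
Proof.
rewrite monicE lead_coefDl ?lead_coefXn // size_polyXn size_polyN.
by rewrite ltnS size_poly.
Qed.

(** If $|x| > B \ge 1$, every term $P_j x^j$ would be at most $B|x|^{n-1} < |x|^n$, so their sum
    could not be $x^n$. *)
Lemma monic_of_root_bound n (P : nat -> K) B x : (0 < n)%N -> 1 <= B ->
  (forall j, (j < n)%N -> v (P j) <= B) -> root (monic_of n P) x -> v x <= B.
Proof.
case: n => // n _ B1 hP; rewrite rootE horner_monic_of subr_eq0 => /eqP hx.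
rewrite leNgt; apply/negP => hB.
have x1 : 1 <= v x := le_trans B1 (ltW hB).
have : v (x ^+ n.+1) <= B * v x ^+ n.
  rewrite hx; apply: vabs_sum_le => [|i _].
    by rewrite mulr_ge0 ?exprn_ge0 ?vabs_ge0 // (le_trans ler01).
  rewrite vabsM vabsX ler_pM ?vabs_ge0 ?exprn_ge0 ?vabs_ge0 ?hP //.
  by rewrite ler_weXn2l // -ltnS.
rewrite vabsX exprS ler_pM2r ?exprn_gt0 ?(lt_le_trans ltr01) //.
by rewrite leNgt hB.
Qed.

Variables (i : {rmorphism L -> K}).
Hypothesis i_dense : forall (y : K) (e : R), 0 < e -> exists x, v (y - i x) < e.
Hypothesis L_closed : GRing.closed_field_axiom L.

(* [x] is close to a root of a nearby polynomial over [L], as the product of its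
   distances to these roots is small. *)
Lemma approx_root_step n (P : nat -> K) B x d d' :
  (0 < n)%N -> (forall j, (j < n)%N -> v (P j) <= B) -> 1 <= B ->
  v x <= B -> 0 < d -> v (monic_of n P).[x] < d ^+ n -> 0 < d' ->
  exists y, [/\ v y <= B, v (y - x) < d & v (monic_of n P).[y] < d'].
Proof.
move=> n0 hP B1 hx d0 hd d'0.
have B0 : 0 < B := lt_le_trans ltr01 B1.
have Bn : 0 < B ^+ n by rewrite exprn_gt0.
(* On $|y| \le B$, changing the coefficients by at most [eta] changes the value by less than both
   $d^n$ and $d'$; the cap 1 keeps the new coefficients bounded by [B]. *)
pose eta := Num.min 1 (Num.min (d ^+ n) d' / (2 * B ^+ n)).
have eta0 : 0 < eta.
  by rewrite lt_min ltr01 divr_gt0 ?lt_min ?exprn_gt0 ?mulr_gt0.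
have [Q hQ] := choice (fun j => i_dense (P j) eta0).
have hQB j : (j < n)%N -> v (i (Q j)) <= B.
  move=> hj; rewrite -[i _](subKr (P j)); apply: vabsB_le; first exact: hP.
  by rewrite (le_trans (ltW (hQ j))) // (le_trans _ B1) // ge_min lexx.
have near y : v y <= B ->
    v ((monic_of n P).[y] - (monic_of n (fun j => i (Q j))).[y])
      < Num.min (d ^+ n) d'.
  move=> hy; rewrite -hornerN -hornerD.
  set F := (_ - _).
  have sF : (size F <= n)%N.
    rewrite /F /monic_of opprB addrC -!addrA addKr addrC.
    by rewrite (leq_trans (size_polyD _ _)) // size_polyN geq_max !size_poly.
  have FC j : v F`_j <= eta.
    rewrite /F /monic_of opprB addrC -!addrA addKr addrC coefD coefN !coef_poly.
    case: ifP => _; last by rewrite ?oppr0 ?addr0 vabs0 ltW.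
    by rewrite addrC vabsC ltW.
  apply: (le_lt_trans (vabs_horner_le hy B1 (ltW eta0) FC)).
  apply: (@le_lt_trans _ _ (eta * B ^+ n)).
    by rewrite ler_wpM2l ?(ltW eta0) // ler_weXn2l.
  have m0 : 0 < Num.min (d ^+ n) d' by rewrite lt_min exprn_gt0.
  apply: (@le_lt_trans _ _ (Num.min (d ^+ n) d' / (2 * B ^+ n) * B ^+ n)).
    by rewrite ler_wpM2r ?(ltW Bn) // ge_min lexx orbT.
  rewrite invfM mulrA mulfVK ?gt_eqF //; lra.
have [rs hrs] := closed_field_split L_closed (monic_of n Q).
move: hrs; rewrite (monicP (monic_of_monic n Q)) scale1r => hrs.
have mapQ : map_poly i (monic_of n Q) = monic_of n (fun j => i (Q j)).
  rewrite /monic_of rmorphB /= map_polyXn; congr (_ - _).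
  by apply/polyP => j; rewrite coef_map !coef_poly; case: ifP => // _; exact: rmorph0.
have gx : (monic_of n (fun j => i (Q j))).[x] = \prod_(b <- rs) (x - i b).
  rewrite -mapQ hrs rmorph_prod horner_prod; apply: eq_bigr => b _.
  by rewrite rmorphB /= map_polyX map_polyC !hornerE.
have small : v (\prod_(b <- rs) (x - i b)) < d ^+ n.
  rewrite -gx -[_.[x]](subKr (monic_of n P).[x]); apply: vabsB_lt => //.
  by apply: lt_le_trans (near x hx) _; rewrite ge_min lexx.
have szrs : size rs = n.
  have := size_prod_XsubC rs id; rewrite -hrs => /eqP.
  rewrite /monic_of size_polyDl ?size_polyXn; first by rewrite eqSS => /eqP.
  by rewrite size_polyN ltnS size_poly.
have [b brs hb] : exists2 b, b \in rs & v (x - i b) < d.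
  have [//|hn] := pselect (exists2 b, b \in rs & v (x - i b) < d).
  move: small; rewrite vabs_prod ltNge -szrs prod_ge_expr ?ltW // => b brs.
  by rewrite leNgt; apply/negP => hb; apply: hn; exists b.
have rootb : root (monic_of n (fun j => i (Q j))) (i b).
  rewrite rootE -mapQ horner_map fmorph_eq0 hrs -rootE root_prod_XsubC //.
have hbB := monic_of_root_bound n0 B1 hQB rootb.
exists (i b); split => //; first by rewrite vabsC.
have := near _ hbB; rewrite (rootP rootb) subr0 => h.
by apply: lt_le_trans h _; rewrite ge_min lexx orbT.
Qed.

(** Iterating [approx_root_step] with $d_k = 2^{-k}$ gives points with $|F(u_k)| < d_k^n$ and
    $|u_{k+1} - u_k| < d_k$. They converge, and the Lipschitz bound on [F] makes the limit a
    root. *)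
Lemma completion_closed : vcomplete K -> GRing.closed_field_axiom K.
Proof.
move=> cK n P n0.
pose B := 1 + \sum_(j < n) v (P j).
have S0 (Q : pred 'I_n) : 0 <= \sum_(j < n | Q j) v (P j).
  by apply: sumr_ge0 => j _; apply: vabs_ge0.
have B1 : 1 <= B by rewrite lerDl.
have hP j : (j < n)%N -> v (P j) <= B.
  by move=> hj; rewrite /B (bigD1 (Ordinal hj)) //= addrCA lerDl addr_ge0.
pose d k : R := 2^-1 ^+ k.
have d0 k : 0 < d k by rewrite /d exprn_gt0 // invr_gt0.
pose F := monic_of n P.
pose good k x := v x <= B /\ v F.[x] < d k ^+ n.
(* The relation is an implication, so that a successor exists for every pair; 0 is a default when
   the pair is not [good]. *)
have [|nxt hnxt] := choice (X := nat * K) (Y := K) (P := fun a y =>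
    good a.1 a.2 -> good a.1.+1 y /\ v (y - a.2) < d a.1).
  move=> [k x] /=; have [[hx hF]|ng] := pselect (good k x); last by exists 0.
  have dn : 0 < d k.+1 ^+ n by rewrite exprn_gt0.
  by have [y [? ? ?]] := approx_root_step n0 hP B1 hx (d0 k) hF dn; exists y.
(* The first step starts from 0 with $d = 1 + |F(0)|$, for which $|F(0)| < d^n$ holds trivially. *)
have [x0 hx0] : exists x, good 0%N x.
  have B0 : v (0 : K) <= B by rewrite vabs0 (le_trans ler01).
  have e0 : 0 < 1 + v F.[0] by rewrite ltr_pwDl ?vabs_ge0.
  have h0 : v F.[0] < (1 + v F.[0]) ^+ n.
    apply: (@lt_le_trans _ _ (1 + v F.[0])); first by rewrite ltrDr.
    by rewrite ler_eXnr // lerDl vabs_ge0.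
  have dn : 0 < d 0%N ^+ n by rewrite exprn_gt0.
  have [y [? ? ?]] := approx_root_step n0 hP B1 B0 e0 h0 dn.
  by exists y.
pose u := fix u k := if k is k'.+1 then nxt (k', u k') else x0.
have hu k : good k (u k) by elim: k => //= k IH; have [] := hnxt (k, u k) IH.
have du k : v (u k.+1 - u k) < d k by have [] := hnxt (k, u k) (hu k).
have dle k m : (k <= m)%N -> d m <= d k.
  by move=> km; rewrite ler_wiXn2l // ?invr_ge0 // invf_le1 // ler1n.
have dN N m : (N <= m)%N -> v (u m - u N) <= d N.
  elim: m => [|m IH]; first by rewrite leqn0 => /eqP ->; rewrite subrr vabs0 ltW.
  rewrite leq_eqVlt => /predU1P[->|hN]; first by rewrite subrr vabs0 ltW.
  apply: (@vdist_le _ _ (u m)); last exact: IH.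
  by apply: le_trans (ltW (du m)) _; apply: dle.
have dsmall e : 0 < e -> exists N, forall k, (N <= k)%N -> d k < e.
  by apply: expr_small; rewrite ?invr_ge0 // invf_lt1 // ltr1n.
have [e e0|l hl] := cK u.
  have [N hN] := dsmall e e0; exists N => m k hm hk.
  apply: le_lt_trans (hN N (leqnn _)); apply: (@vdist_le _ _ (u N)); first exact: dN.
  by rewrite vabsC dN.
exists l; apply/eqP; rewrite -subr_eq0 -horner_monic_of; apply/eqP/vabs_eq0_le => e e0.
have [M M0 hM] := vabs_horner_lip F (Num.max B (v l)).
have [N hN] := hl (e / M) (divr_gt0 e0 M0); have [N' hN'] := dsmall e e0.
pose k := maxn N N'.
have [hk1 hk2] := hu k.
have {}hN := hN k (leq_maxl _ _); have {}hN' := hN' k (leq_maxr _ _).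
rewrite -[_.[l]](subrK F.[u k]); apply: vabsD_le.
  apply: (le_trans (hM _ _ _ _)); rewrite ?le_max ?lexx ?orbT ?hk1 //.
  by rewrite vabsC mulrC -ler_pdivlMr // ltW.
apply: le_trans (ltW hk2) _; apply: le_trans (ltW hN').
by rewrite ler_iXnr ?(ltW (d0 _)) // (dle 0%N).
Qed.

End CompletionClosed.

(** * Arithmetic of C_p and its residue field *)

Section PadicNat.
Context {R : realType} {K : valuedFieldType R}.
Variable p : nat.
Hypothesis p_prime : prime p.
Hypothesis vabs_p : vabs (p%:R : K) = p%:R^-1.
Notation v := (@vabs R K).

Lemma vabs_p_lt1 : v p%:R < 1.
Proof. by rewrite vabs_p invf_lt1 ?ltr1n ?ltr0n ?prime_gt1 ?prime_gt0. Qed.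

Lemma vabs_dvdn_lt1 n : (p %| n)%N -> v n%:R < 1.
Proof.
move=> /dvdnP[m ->]; rewrite natrM vabsM (le_lt_trans _ vabs_p_lt1) //.
by rewrite ler_piMl ?vabs_ge0 ?vabs_natr_le1.
Qed.

Lemma vabs_dvdz_lt1 (n : int) : (p %| n)%Z -> v n%:~R < 1.
Proof.
by case: n => n h; rewrite ?NegzE ?mulrNz ?vabsN; apply: vabs_dvdn_lt1.
Qed.

(** By Euler, $n^{\varphi(p)}$ is 1 plus a multiple of $p$, hence of absolute value 1. *)
Lemma vabs_coprime n : coprime n p -> v n%:R = 1.
Proof.
move=> cnp; apply/eqP; rewrite eq_le vabs_natr_le1 /=.
have e0 : (0 < totient p)%N by rewrite totient_gt0 prime_gt0.
have n0 : (0 < n)%N.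
  by case: n cnp => //; rewrite /coprime gcd0n => /eqP p1; move: p_prime; rewrite p1.
have h : (p %| n ^ totient p - 1)%N.
  by rewrite -eqn_mod_dvd ?expn_gt0 ?n0 //; apply/eqP/Euler_exp_totient.
have : v (n ^ totient p)%:R = 1.
  rewrite -(subnK (_ : 1 <= n ^ totient p)%N) ?expn_gt0 ?n0 // natrD.
  by rewrite vabsDl_eq vabs1 // vabs_dvdn_lt1.
by rewrite natrX vabsX => /eqP; rewrite pexpr_eq1 ?vabs_ge0 // => /eqP ->.
Qed.

(** Write $n = m p^k$ with $m$ prime to $p$: then $|m| = 1$ and $|p| \ne 0$. *)
Lemma natr_neq0 n : (0 < n)%N -> n%:R != 0 :> K.
Proof.
move=> n0; have [m cpm ->] := pfactor_coprime p_prime n0.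
rewrite natrM natrX mulf_neq0 ?expf_neq0 //; apply/eqP => h.
  by have := @vabs_coprime m; rewrite h vabs0 coprime_sym cpm => /(_ isT)
    /esym/eqP; rewrite oner_eq0.
move: vabs_p; rewrite h vabs0 => /esym/eqP.
by rewrite invr_eq0 pnatr_eq0 -leqn0 leqNgt prime_gt0.
Qed.

Lemma vabs_horner_lt1 (P : {poly K}) x : v x <= 1 -> (forall j, v P`_j < 1) ->
  v P.[x] < 1.
Proof.
move=> hx hP; rewrite horner_coef; apply: vabs_sum_lt => // i _.
rewrite vabsM vabsX; apply: le_lt_trans (hP i).
by rewrite ler_piMr ?vabs_ge0 // exprn_ile1 ?vabs_ge0.
Qed.

Lemma vabs_horner_le1 (P : {poly K}) x : v x <= 1 -> (forall j, v P`_j <= 1) ->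
  v P.[x] <= 1.
Proof. by move=> hx hP; have := vabs_horner_le hx (lexx 1) ler01 hP; rewrite expr1n mulr1. Qed.

(* Pigeonhole: modulo [mu] and [p], the powers of [x] take finitely many values. *)
Lemma monic_int_residue (mu : {poly int}) x : mu \is monic -> v x = 1 ->
  v (map_poly intr mu).[x] < 1 -> exists2 n, (0 < n)%N & v (x ^+ n - 1) < 1.
Proof.
move=> mon hx hmu; have hx1 : v x <= 1 by rewrite hx.
pose r i : {poly int} := Pdiv.CommonRing.rmodp 'X^i mu.
pose ev (P : {poly int}) : K := (map_poly intr P).[x].
have evle P : v (ev P) <= 1.
  by apply: vabs_horner_le1 => // j; rewrite coef_map vabs_intr_le1.
have hr i : v (x ^+ i - ev (r i)) < 1.
  have -> : x ^+ i - ev (r i) = ev (Pdiv.CommonRing.rdivp 'X^i mu) * ev mu.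
    have := congr1 ev (Pdiv.RingMonic.rdivp_eq mon 'X^i).
    rewrite /ev rmorphD rmorphM /= hornerD hornerM map_polyXn hornerXn => ->.
    by rewrite addrK.
  by rewrite vabsM (le_lt_trans _ hmu) // ler_piMl ?vabs_ge0.
have sr i : (size (r i) <= (size mu).-1)%N.
  rewrite -ltnS prednK ?size_poly_gt0 ?monic_neq0 //.
  by apply: Pdiv.CommonRing.ltn_rmodpN0; rewrite monic_neq0.
pose d := (size mu).-1.
(* There are $p^d + 1$ exponents, but only $p^d$ vectors of coefficients modulo $p$ for remainders
   of degree less than $d$. *)
pose f (i : 'I_(p ^ d).+1) := [ffun j : 'I_d => ((r i)`_j)%:~R : 'F_p].
have /injectivePn [i [j nij fij]] : ~~ injectiveb f.
  apply/injectiveP => /leq_card; rewrite card_ord card_ffun card_Fp // card_ord.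
  by rewrite ltnn.
have hd : v (ev (r i) - ev (r j)) < 1.
  rewrite /ev -hornerN -hornerD -rmorphB; apply: vabs_horner_lt1 => // k.
  rewrite coef_map; apply: vabs_dvdz_lt1; rewrite coefB.
  have [hk|hk] := ltnP k d; last by rewrite !nth_default ?subrr ?dvdz0 // (leq_trans (sr _)).
  rewrite (dvdz_pcharf (pchar_Fp p_prime)) rmorphB subr_eq0 /=.
  by move/ffunP/(_ (Ordinal hk)): fij; rewrite !ffunE => /eqP.
have hij : v (x ^+ i - x ^+ j) < 1.
  apply: (vdist_lt (hr i)); apply: (vdist_lt hd).
  by rewrite vabsC.
have gen (a b : nat) : (a < b)%N -> v (x ^+ a - x ^+ b) < 1 ->
    exists2 n, (0 < n)%N & v (x ^+ n - 1) < 1.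
  move=> ab; rewrite vabsC -(subnK (ltnW ab)) exprD -[X in _ - X]mul1r -mulrBl.
  rewrite vabsM vabsX hx expr1n mulr1 => h.
  by exists (b - a)%N => //; rewrite subn_gt0.
case: (ltngtP i j) => [ij|ji|/val_inj eij]; first exact: gen hij.
  by apply: gen ji _; rewrite vabsC.
by rewrite eij eqxx in nij.
Qed.

End PadicNat.

Section PadicComplexFacts.
Context {R : realType}.
Variable p : nat.
Hypothesis p_prime : prime p.

Lemma padic_abs_p : @padic_abs R p p%:R = p%:R^-1.
Proof.
have p0 : (p%:R : rat) != 0 by rewrite pnatr_eq0 -lt0n prime_gt0.
have -> : (p%:R : rat) = p%:Z%:Q by [].
rewrite /padic_abs (negPf p0) denq_int numq_int /= logn1 expr0 mul1r.
by rewrite logn_prime // eqxx expr1.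
Qed.

(** Dividing a polynomial by the last of its largest coefficients makes it integral and, modulo the
    maximal ideal, monic of degree [d]. *)
Lemma last_max (f : nat -> R) N : exists d,
  [/\ (d <= N)%N, forall j, (j <= N)%N -> f j <= f d
    & forall j, (j <= N)%N -> (d < j)%N -> f j < f d].
Proof.
elim: N => [|N [d [dN hd hd']]].
  by exists 0%N; split => // j; rewrite leqn0 => /eqP ->.
have [h|h] := leP (f d) (f N.+1).
  exists N.+1; split => // [j|j hj]; last by rewrite ltnNge hj.
  rewrite leq_eqVlt => /predU1P[-> //|]; rewrite ltnS => /hd; move: h => /[swap]; exact: le_trans.
exists d; split => [|j|j]; first exact: leqW.
  rewrite leq_eqVlt => /predU1P[->|]; [exact: ltW|exact: hd].
rewrite leq_eqVlt => /predU1P[-> //|hj dj]; exact: hd'.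
Qed.

(** The residue field of $\mathbb{Q}_p$ is $\mathbb{F}_p$. A rational $m/N$ close to $x$ has $N$
    prime to $p$, and $N^{\varphi(p)-1}$ inverts $N$ modulo $p$. *)
Lemma padic_int_approx (Qp : valuedFieldType R) (i : {rmorphism rat -> Qp}) :
  (forall x, vabs (i x) = padic_abs p x) ->
  (forall (y : Qp) (e : R), 0 < e -> exists x, vabs (y - i x) < e) ->
  forall x : Qp, vabs x <= 1 -> exists m : int, vabs (x - m%:~R) < 1.
Proof.
move=> isom dense x hx.
have hp : vabs (p%:R : Qp) = p%:R^-1 by rewrite -(rmorph_nat i) isom padic_abs_p.
have [q hq] := dense x 1 ltr01.
have hq1 : vabs (i q) <= 1 by rewrite -[i q](subKr x) vabsB_le // ltW.
pose N := `|denq q|%N.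
have dN : (denq q)%:~R = N%:R :> Qp by rewrite -[denq q]gez0_abs ?denq_ge0.
have N0 : (0 < N)%N by rewrite absz_gt0 denq_neq0.
(* If $p$ divided the denominator it would not divide the numerator, and $|q|$ would exceed 1. *)
have cNp : coprime N p.
  rewrite coprime_sym prime_coprime //; apply/negP => pN.
  have q0 : q != 0.
    by apply: contraTneq pN => q0; rewrite /N q0 (denq_int 0) dvdn1 neq_ltn prime_gt1 ?orbT.
  move: hq1; rewrite isom /padic_abs (negPf q0).
  have -> : logn p `|numq q| = 0%N.
    have [//|] := posnP (logn p `|numq q|); rewrite logn_gt0 mem_primes => /and3P[_ _ pn].
    have : (p %| gcdn `|numq q| `|denq q|)%N by rewrite dvdn_gcd pn.
    by rewrite (eqP (coprime_num_den q)) dvdn1 => /eqP p1; move: p_prime; rewrite p1.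
  rewrite expr0 divr1 leNgt exprn_egt1 ?ltr1n ?prime_gt1 //.
  by rewrite -lt0n logn_gt0 mem_primes p_prime N0 pN.
pose e := totient p; have e0 : (0 < e)%N by rewrite totient_gt0 prime_gt0.
have h : vabs ((N ^ e)%:R - 1 : Qp) < 1.
  rewrite -(natrB _ (_ : 1 <= _)%N) ?expn_gt0 ?N0 //; apply: (vabs_dvdn_lt1 p_prime hp).
  by rewrite -eqn_mod_dvd ?expn_gt0 ?N0 //; apply/eqP/Euler_exp_totient.
exists (numq q * (N ^ e.-1)%:Z).
apply: (vdist_lt hq); rewrite rmorphM /= vabsC.
have -> : (numq q)%:~R = i q * N%:R.
  by have := congr1 i (numqE q); rewrite rmorphM !rmorph_int dN.
rewrite -mulrA -[X in _ - X]mulr1 -mulrBr vabsM -natrM -expnS prednK //.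
by apply: le_lt_trans h; rewrite ler_piMl ?vabs_ge0.
Qed.

(** The properties of $\mathbb{C}_p$ from which everything below is derived, so that the tower of
    fields is visited only once. *)
Record padic_like (K : valuedFieldType R) : Prop := PadicLike {
  pl_complete : vcomplete K;
  pl_closed : GRing.closed_field_axiom K;
  pl_p : vabs (p%:R : K) = p%:R^-1;
  (* the residue field is algebraic over the prime field *)
  pl_residue : forall x : K, vabs x = 1 ->
    exists2 n, (0 < n)%N & vabs (x ^+ n - 1) < 1
}.

(** For the residue field, density replaces $x$ by some $y$ algebraic over $\mathbb{Q}_p$. An
    equation of $y$, divided by the last of its largest coefficients and rounded to integers, yields
    a monic integral [mu] with $|\mu(y)| < 1$, and [monic_int_residue] applies. *)
Lemma padic_complex_like (C : valuedFieldType R) :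
  is_padic_complex p C -> padic_like C.
Proof.
case=> Qp [L [[cQ [i0 [isom0 dense0]]] [clL [i1 [isom1 alg1]]]
  [cC [i2 [isom2 dense2]]]]].
have hpQ : vabs (p%:R : Qp) = p%:R^-1 by rewrite -(rmorph_nat i0) isom0 padic_abs_p.
have hpL : vabs (p%:R : L) = p%:R^-1 by rewrite -(rmorph_nat i1) isom1.
have hpC : vabs (p%:R : C) = p%:R^-1 by rewrite -(rmorph_nat i2) isom2.
split => // [|x hx]; first exact: (completion_closed dense2 clL cC). 
have [y hy] := dense2 x 1 ltr01.
have hy1 : vabs y = 1.
  by rewrite -isom2 -hx; apply: vabs_close; rewrite vabsC hx.
suff [n n0 hn] : exists2 n, (0 < n)%N & vabs (y ^+ n - 1) < 1.
  exists n => //; rewrite -isom2 rmorphB rmorphXn rmorph1 /= in hn.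
  apply: vdist_lt hn; rewrite subrXX vabsM; apply: le_lt_trans hy.
  rewrite ler_piMr ?vabs_ge0 //; apply: vabs_sum_le => // j _.
  by rewrite vabsM !vabsX isom2 hx hy1 !expr1n mulr1.
have [P P0 rP] := alg1 y.
have [d [ds dmax dlt]] := last_max (fun j => vabs P`_j) (size P).
have Pd0 : P`_d != 0.
  apply: contra_neq P0 => Pd; apply/eqP; rewrite -lead_coef_eq0; apply/eqP/vabs_eq0.
  by apply/le_anti; rewrite vabs_ge0 andbT (le_trans (dmax _ (leq_pred _))) // Pd vabs0.
pose c j := P`_j / P`_d.
have cj j : vabs (c j) <= 1.
  rewrite vabs_div ler_pdivrMr ?mul1r ?vabs_gt0 //.
  have [/dmax //|h] := leqP j (size P).
  by rewrite nth_default ?vabs0 ?vabs_ge0 // ltnW.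
have cj' j : (d < j)%N -> vabs (c j) < 1.
  move=> dj; rewrite vabs_div ltr_pdivrMr ?mul1r ?vabs_gt0 //.
  have [h|h] := leqP j (size P); first exact: dlt.
  by rewrite nth_default ?vabs0 ?vabs_gt0 // ltnW.
have [m hm] := choice (fun j => padic_int_approx isom0 dense0 (cj j)).
pose mu : {poly int} := monic_of d (fun j => - m j).
apply: (@monic_int_residue _ _ p _ _ mu) => //; first exact: monic_of_monic.
(* The subtracted multiple of [P] vanishes at [y], and the difference has all its coefficients of
   absolute value less than 1. *)
have -> : (map_poly intr mu).[y] =
    (map_poly intr mu - map_poly i1 ((P`_d)^-1 *: P)).[y].
  rewrite hornerD hornerN map_polyZ hornerZ (rootP rP) mulr0 subr0 //.
apply: vabs_horner_lt1 => [|j]; first by rewrite hy1.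
have -> : (map_poly intr mu - map_poly i1 ((P`_d)^-1 *: P))`_j
    = i1 ((mu`_j)%:~R - c j).
  by rewrite coefB !coef_map /= coefZ rmorphB rmorph_int mulrC.
rewrite isom1 /mu /monic_of coefB coefXn coef_poly.
have [jd|dj|->] := ltngtP j d.
- by rewrite sub0r opprK vabsC hm.
- by rewrite subr0 sub0r vabsN cj'.
- by rewrite subr0 /c divff // subrr vabs0.
Qed.

End PadicComplexFacts.

(** * Roots of unity *)

Section PadicPowers.
Context {R : realType} {K : valuedFieldType R}.
Variable p : nat.
Hypotheses (p_prime : prime p) (p_odd : odd p) (hK : padic_like p K).
Notation v := (@vabs R K).
Implicit Types (x y u w z : K).

Let p_gt0 : (0 < p)%N. Proof. exact: prime_gt0. Qed.

(** Modulo $p$, $(x-1)^p$ is $x^p - 1$: the middle binomial coefficients are divisible by $p$, and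
    $(-1)^p = -1$ as $p$ is odd. *)
Lemma frobenius_sub1 x : v x <= 1 -> v (x ^+ p - 1) < 1 -> v (x - 1) < 1.
Proof.
move=> hx h; rewrite ltNge; apply/negP => h1.
have hx1 : v (x - 1) = 1 by apply/le_anti; rewrite vabsB_le ?vabs1.
suff : v ((x - 1) ^+ p) < 1 by rewrite vabsX hx1 expr1n ltxx.
rewrite exprBn (bigD1 ord0) //= (bigD1 ord_max) /=; last first.
  by rewrite -val_eqE /= -lt0n.
rewrite expr0 mul1r mulr1 subn0 bin0 mulr1n subnn expr0 mulr1 expr1n mulr1 binn mulr1n.
rewrite -signr_odd p_odd expr1 addrA; apply: vabsD_lt => //.
apply: vabs_sum_lt => // -[i hi] /andP[i0 ip]; rewrite -mulr_natr vabsM.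
rewrite -!val_eqE /= in i0 ip.
have hb : v 'C(p, i)%:R < 1.
  apply: (vabs_dvdn_lt1 p_prime (pl_p hK)); apply: prime_dvd_bin => //.
  by rewrite lt0n i0 ltn_neqAle ip -ltnS.
apply: le_lt_trans hb; rewrite ler_piMl ?vabs_ge0 // expr1n mulr1 vabsM !vabsX vabsN vabs1.
by rewrite expr1n mul1r exprn_ile1 ?vabs_ge0.
Qed.

Lemma frobenius_iter_sub1 n x : v x <= 1 -> v (x ^+ (p ^ n) - 1) < 1 -> v (x - 1) < 1.
Proof.
elim: n => [|n IH] hx; first by rewrite expn0 expr1.
rewrite expnSr exprM => h; apply: IH => //; apply: frobenius_sub1 h.
by rewrite vabsX exprn_ile1 ?vabs_ge0.
Qed.

Lemma vabs_subXn n x y : v x <= 1 -> v y <= 1 -> v (x ^+ n - y ^+ n) <= v (x - y).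
Proof.
move=> hx hy; rewrite subrXX vabsM ler_piMr ?vabs_ge0 //.
apply: vabs_sum_le => // i _.
by rewrite vabsM !vabsX mulr_ile1 ?exprn_ge0 ?vabs_ge0 // exprn_ile1 ?vabs_ge0.
Qed.

(** The cofactor $\sum_i x^{p-1-i} y^i$ of $x - y$ differs from $p\,y^{p-1}$ by at most $|x - y|$,
    so it is bounded by $q$. *)
Lemma frobenius_contract x y q : v x <= 1 -> v y <= 1 -> v (x - y) <= q ->
  p%:R^-1 <= q -> v (x ^+ p - y ^+ p) <= v (x - y) * q.
Proof.
move=> hx hy hq pq; rewrite subrXX vabsM ler_wpM2l ?vabs_ge0 //.
have q0 : 0 <= q := le_trans (vabs_ge0 _) hq.
have -> : \sum_(i < p) x ^+ (p.-1 - i) * y ^+ i =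
   \sum_(i < p) (x ^+ (p.-1 - i) - y ^+ (p.-1 - i)) * y ^+ i + p%:R * y ^+ p.-1.
  rewrite mulr_natl -[p in _ *+ p]card_ord -sumr_const -big_split /=.
  apply: eq_bigr => i _; rewrite mulrBl -exprD subnK ?subrK //.
  by rewrite -ltnS prednK.
apply: vabsD_le.
  apply: vabs_sum_le => // i _; rewrite vabsM vabsX; apply: (@le_trans _ _ (v (x - y))) => //.
  apply: le_trans (vabs_subXn (p.-1 - i) hx hy).
  by rewrite ler_piMr ?vabs_ge0 // exprn_ile1 ?vabs_ge0.
rewrite vabsM (pl_p hK); apply: le_trans pq; rewrite ler_piMr ?invr_ge0 ?ler0n //.
by rewrite vabsX exprn_ile1 ?vabs_ge0.
Qed.

(** Each $p$-th power contracts the distance by the factor $q = \max(|x-y|, 1/p) < 1$. *)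
Lemma expp_close x y : v x <= 1 -> v y <= 1 -> v (x - y) < 1 ->
  forall e, 0 < e -> exists N, forall n, (N <= n)%N ->
    v (x ^+ (p ^ n) - y ^+ (p ^ n)) < e.
Proof.
move=> hx hy hxy e e0; pose q := Num.max (v (x - y)) p%:R^-1.
have q0 : 0 <= q by rewrite le_max vabs_ge0.
have q1 : q < 1 by rewrite gt_max hxy /= -(pl_p hK) vabs_p_lt1 // (pl_p hK).
have hn n : v (x ^+ (p ^ n) - y ^+ (p ^ n)) <= q ^+ n.+1.
  elim: n => [|n IH]; first by rewrite expn0 !expr1 le_max lexx.
  have le1 (a : K) : v a <= 1 -> v (a ^+ (p ^ n)) <= 1.
    by move=> ha; rewrite vabsX exprn_ile1 ?vabs_ge0.
  rewrite expnSr !exprM; apply: (@le_trans _ _ (v (x ^+ (p ^ n) - y ^+ (p ^ n)) * q)).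
    apply: frobenius_contract; [exact: le1|exact: le1| |by rewrite le_max lexx orbT].
    by apply: le_trans IH _; rewrite exprS ler_piMr // exprn_ile1 // ltW.
  by rewrite exprSr ler_wpM2r.
have [N hN] := expr_small q0 q1 e0; exists N => n hNn.
by apply: le_lt_trans (hn n) (hN _ (leqW hNn)).
Qed.

Lemma prim_root_ex n : (0 < n)%N -> exists z : K, n.-primitive_root z.
Proof.
move=> n0; have [rs] := closed_field_split (pl_closed hK) ('X^n - 1).
have /monicP -> := monic_Xn_sub_1 K n0; rewrite scale1r => hrs.
have nn : n%:R != 0 :> K := natr_neq0 p_prime (pl_p hK) n0.
have urs : uniq rs.
  rewrite -separable_prod_XsubC -hrs unlock.
  (* Separability comes from $-n(X^n - 1) + X \cdot nX^{n-1} = n$, a non-zero constant. *)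
  apply/Bezout_coprimepP; exists (- n%:R%:P, 'X) => /=.
  rewrite derivB derivXn derivC subr0 mulrnAr -exprS prednK // rmorph_nat.
  rewrite mulNr mulrBr mulr1 opprB mulr_natl subrK -polyC_natr polyC_eqp1.
  exact: nn.
have srs : size rs = n by have := size_prod_XsubC rs id; rewrite -hrs size_Xn_sub_1 // => -[].
have all_rs : all n.-unity_root rs.
  apply/allP => x xrs; rewrite -[_ x]/(root ('X^n - 1) x) hrs.
  by rewrite root_prod_XsubC.
have /hasP[z _ hz] := has_prim_root n0 all_rs urs (eq_leq (esym srs)).
by exists z.
Qed.

(** The residue field has characteristic $p$, so roots of unity of $p$-power order reduce to 1. This
    places the points of [root_mean] in the arc. *)
Lemma unity_close n z : z ^+ (p ^ n) = 1 -> v (z - 1) < 1.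
Proof.
move=> hz; apply: (@frobenius_iter_sub1 n); last by rewrite hz subrr vabs0.
have /eqP : v z ^+ (p ^ n) = 1 by rewrite -vabsX hz vabs1.
by rewrite pexpr_eq1 ?vabs_ge0 ?expn_gt0 ?p_gt0 // => /eqP ->.
Qed.

Lemma prod_unity n z x : n.-primitive_root z ->
  \prod_(i < n) (x - z ^+ i) = x ^+ n - 1.
Proof.
move=> hz; have := congr1 (horner^~ x) (factor_Xn_sub_1 hz).
rewrite !hornerE => <-; rewrite horner_prod big_mkord.
by apply: eq_bigr => i _; rewrite !hornerE.
Qed.

Lemma sum_unity n z m : n.-primitive_root z ->
  \sum_(i < n) (z ^+ i) ^+ m = if (n %| m)%N then n%:R else 0.
Proof.
move=> hz; under eq_bigr do rewrite exprAC.
case: ifPn => [|]; rewrite (prim_order_dvd hz) => hm.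
  rewrite (eqP hm); under eq_bigr do rewrite expr1n.
  by rewrite sumr_const card_ord.
have : (z ^+ m) ^+ n - 1 = 0 by rewrite exprAC (prim_expr_order hz) expr1n subrr.
by rewrite subrX1 => /eqP; rewrite mulf_eq0 subr_eq0 (negPf hm) => /eqP.
Qed.

Lemma mean_unity_poly n z (P : {poly K}) : n.-primitive_root z ->
  forall m, (size P <= m)%N ->
  n%:R^-1 * \sum_(i < n) P.[z ^+ i] = \sum_(j < m | (n %| j)%N) P`_j.
Proof.
move=> hz m hm; under eq_bigr do rewrite (horner_coef_wide _ hm).
rewrite exchange_big mulr_sumr [RHS]big_mkcond /=; apply: eq_bigr => j _.
rewrite -mulr_sumr (sum_unity _ hz); case: ifP => _; last by rewrite !mulr0.
by rewrite mulrC mulfK // (natr_neq0 p_prime (pl_p hK)) // (prim_order_gt0 hz).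
Qed.

Lemma mean_unity_poly_small n z (P : {poly K}) : n.-primitive_root z ->
  (size P <= n.+1)%N ->
  n%:R^-1 * \sum_(i < n) P.[z ^+ i] = P`_0 + P`_n.
Proof.
move=> hz hP; rewrite (mean_unity_poly hz hP) (bigD1 ord0) //= (bigD1 ord_max) /=.
  rewrite big1 ?addr0 // => i /andP[/andP[ni i0] iN]; exfalso.
  rewrite -!val_eqE /= in i0 iN; have := dvdn_leq _ ni; rewrite lt0n i0 => /(_ isT).
  by rewrite leqNgt ltn_neqAle iN -ltnS ltn_ord.
by rewrite dvdnn -val_eqE /= -lt0n (prim_order_gt0 hz).
Qed.

End PadicPowers.

(** * Gauss norms and means over roots of unity of order a power of p *)

Section GaussNorm.
Context {R : realType} {K : valuedFieldType R}.
Notation v := (@vabs R K).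
Implicit Types (P Q : {poly K}) (B e : R).

Definition coef_bounded B P := forall j, v P`_j <= B.

Lemma coef_boundedM B B' P Q : coef_bounded B P -> coef_bounded B' Q ->
  coef_bounded (B * B') (P * Q).
Proof.
move=> hP hQ j; have B0 := le_trans (vabs_ge0 _) (hP 0%N).
have B'0 := le_trans (vabs_ge0 _) (hQ 0%N).
rewrite coefM; apply: vabs_sum_le => [|i _]; first exact: mulr_ge0.
by rewrite vabsM ler_pM ?vabs_ge0.
Qed.

Lemma coef_bounded_sum B I (r : seq I) (F : I -> {poly K}) : 0 <= B ->
  (forall i, coef_bounded B (F i)) -> coef_bounded B (\sum_(i <- r) F i).
Proof. by move=> B0 h j; rewrite coef_sum; apply: vabs_sum_le => // i _; apply: h. Qed.

Lemma coef_boundedX n : coef_bounded 1 'X^n.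
Proof. by move=> j; rewrite coefXn; apply: vabs_natr_le1. Qed.

(** The powers of ['X - 1] have coefficients of absolute value at most 1, so a translation by 1 does
    not increase the Gauss norm. *)
Lemma coef_bounded_comp B P : coef_bounded B P -> coef_bounded B (P \Po ('X - 1)).
Proof.
move=> hP; have B0 := le_trans (vabs_ge0 _) (hP 0%N).
rewrite comp_polyE; apply: coef_bounded_sum => // i.
have hX : coef_bounded 1 (('X - 1) ^+ i).
  elim: (val i) => [|k IH]; first by rewrite expr0; apply: (@coef_boundedX 0).
  rewrite exprS -[X in coef_bounded X]mulr1; apply: coef_boundedM => // j.
  by rewrite coefB vabsB_le // ?coef1 ?coefX vabs_natr_le1.
by move=> j; rewrite coefZ vabsM -[B]mulr1 ler_pM ?vabs_ge0.
Qed.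

Variable p : nat.
Hypotheses (p_prime : prime p) (p_odd : odd p) (hK : padic_like p K).

(** Roots of $p$ of high order have absolute value less than 1 but arbitrarily close to 1. *)
Lemma vabs_dense_lt1 (q : R) j : q < 1 -> exists2 t : K, v t < 1 & q < v t ^+ j.
Proof.
move=> q1; case: j => [|j]; first by exists 0; rewrite ?vabs0 ?expr0.
pose q' := Num.max q 0.
have q'0 : 0 <= q' by rewrite le_max lexx orbT.
have q'1 : q' < 1 by rewrite gt_max q1 ltr01.
have p0 : 0 < (p%:R^-1 : R) by rewrite invr_gt0 ltr0n prime_gt0.
have [N hN] := expr_small q'0 q'1 p0.
have [t ht] := pl_closed hK (fun i => if i == 0%N then p%:R else 0) (ltn0Sn (j.+1 * N.+1).-1).
rewrite prednK ?muln_gt0 // in ht.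
have {}ht : (v t ^+ j.+1) ^+ N.+1 = p%:R^-1.
  rewrite -exprM -vabsX ht -(pl_p hK); congr v.
  rewrite (bigD1 (Ordinal (_ : 0 < j.+1 * N.+1)%N)) //= expr0 mulr1 big1 ?addr0 //.
  by move=> i /negPf; rewrite -val_eqE /= => ->; rewrite mul0r.
exists t.
  rewrite ltNge; apply/negP => t1.
  have := exprn_ege1 N.+1 (exprn_ege1 j.+1 t1); rewrite ht leNgt.
  by rewrite -(pl_p hK) (vabs_p_lt1 p_prime (pl_p hK)).
apply: (@le_lt_trans _ _ q'); first by rewrite le_max lexx.
rewrite ltNge; apply/negP => h; have := hN _ (leqnSn N).
by rewrite ltNge -ht lerXn2r // ?nnegrE ?exprn_ge0 ?vabs_ge0.
Qed.

(* For [n] prime to [p] the mean over the [n]-th roots of unity is bounded, and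
   it extracts the coefficients. *)
Lemma coef_bounded_sup P e : (forall t, v t < 1 -> v P.[t] <= e) -> coef_bounded e P.
Proof.
move=> hP j; have e0 : 0 <= e.
  by apply: le_trans (hP 0 _); rewrite ?vabs_ge0 // vabs0.
have [hj|hj] := leqP (size P) j; first by rewrite nth_default // vabs0.
have key t : v t < 1 -> v P`_j * v t ^+ j <= e.
  (* This [n] is 1 modulo $p$, so $|n| = 1$, and it exceeds all exponents of [P], so no two of them
     agree modulo [n]. *)
  move=> ht; pose n := (p * size P).+1.
  have sn : (size P <= n)%N by rewrite leqW // leq_pmull // prime_gt0.
  have hn : v n%:R = 1.
    apply: (vabs_coprime p_prime (pl_p hK)); rewrite /n -addn1 coprime_sym.
    by rewrite /coprime gcdnC -(gcdnC p) mulnC gcdnMDl gcdn1.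
  have [z hz] := prim_root_ex p_prime hK (ltn0Sn (p * size P)).
  (* The factor $\zeta^{n-j} = \zeta^{-j}$ isolates the coefficient of index [j]. *)
  have -> : v P`_j * v t ^+ j =
     v (n%:R^-1 * \sum_(i < n) (z ^+ i) ^+ (n - j) * P.[t * z ^+ i]).
    rewrite -vabsX -vabsM; congr v.
    under eq_bigr do rewrite horner_coef mulr_sumr.
    have E k : \sum_(i < n) (z ^+ i) ^+ (n - j) * (P`_k * (t * z ^+ i) ^+ k)
        = P`_k * t ^+ k * (if (n %| n - j + k)%N then n%:R else 0).
      rewrite -(sum_unity _ hz) mulr_sumr; apply: eq_bigr => i _.
      by rewrite exprMn exprD; ring.
    have jn : (j < n)%N := leq_trans hj sn.
    rewrite exchange_big /= (bigD1 (Ordinal hj)) //= E.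
    rewrite subnK ?(ltnW jn) // dvdnn big1 ?addr0 => [|i ij].
      by rewrite mulrCA mulVf ?mulr1 // (natr_neq0 p_prime (pl_p hK)).
    rewrite E; case: ifP => [/dvdnP[q hq]|]; last by rewrite mulr0.
    have i_lt : (i < n)%N := leq_trans (ltn_ord i) sn.
    suff ij' : i = j :> nat by move: ij; rewrite -val_eqE /= ij' eqxx.
    by case: q hq => [|[|q]]; nia.
  rewrite vabsM vabsV hn invr1 mul1r; apply: vabs_sum_le => // i _.
  have hzi : v (z ^+ i) = 1.
    have /eqP : v z ^+ n = 1 by rewrite -vabsX (prim_expr_order hz) vabs1.
    by rewrite pexpr_eq1 ?vabs_ge0 // vabsX => /eqP ->; rewrite expr1n.
  by rewrite vabsM vabsX hzi expr1n mul1r hP // vabsM hzi mulr1.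
rewrite leNgt; apply/negP => hlt.
have P0 : 0 < v P`_j := le_lt_trans e0 hlt.
have [t t1] : exists2 t, v t < 1 & e / v P`_j < v t ^+ j.
  by apply: vabs_dense_lt1; rewrite ltr_pdivrMr // mul1r.
by rewrite ltr_pdivrMr // mulrC ltNge key.
Qed.

(** * Means of rational functions without poles in $D^-(1,1)$ *)

Section Mean.
Variables (n : nat) (z : K).
Hypothesis hz : (p ^ n).-primitive_root z.
Let N := (p ^ n)%N.

Let N_gt0 : (0 < N)%N. Proof. by rewrite expn_gt0 prime_gt0. Qed.

(** In $c^N - 1 = \prod_i (c - z^i)$ every factor has absolute value $|c - 1|$, since $|z^i - 1| < 1
    \le |c - 1|$. *)
Lemma vabs_subX1 c : 1 <= v (c - 1) -> v (c ^+ N - 1) = v (c - 1) ^+ N.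
Proof.
move=> hc; rewrite -(prod_unity c hz) vabs_prod -[X in _ ^+ X]card_ord -prodr_const.
apply: eq_bigr => i _.
rewrite vabsC [RHS]vabsC; apply: vdist_close; rewrite [X in _ < X]vabsC.
apply: lt_le_trans hc; apply: (unity_close p_prime p_odd hK (n := n)).
by rewrite exprAC (prim_expr_order hz) expr1n.
Qed.

Definition inv_poly c : {poly K} :=
  \poly_(i < N) (c ^+ (N.-1 - i) / (1 - c ^+ N)).

(** $(x - c)\sum_i x^i c^{N-1-i} = x^N - c^N = 1 - c^N$, which is non-zero because $|c^N - 1| = |c -
    1|^N \ge 1$. *)
Lemma inv_polyE c x : 1 <= v (c - 1) -> x ^+ N = 1 -> (inv_poly c).[x] = (x - c)^-1.
Proof.
move=> hc hx; have cN : 1 - c ^+ N != 0.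
  apply: contraTneq isT => h; have := vabs_subX1 hc; rewrite -vabsN opprB h vabs0.
  move/esym/eqP; rewrite expf_eq0 N_gt0 => /eqP h'.
  by move: hc; rewrite h' ler10.
have xc : x - c != 0.
  by apply: contra_neq cN => /subr0_eq <-; rewrite hx subrr.
apply: (mulfI xc); rewrite divff // /inv_poly horner_poly.
under eq_bigr do rewrite mulrAC.
rewrite -mulr_suml mulrA; apply: (mulIf cN); rewrite mulfVK // mul1r.
by rewrite -{1}hx -[RHS]opprB subrXX -mulNr opprB.
Qed.

(** Since $|c| \le |c - 1|$, each numerator is at most $|c-1|^{N-1}$, while the denominator has
    absolute value $|c-1|^N$. *)
Lemma inv_poly_bounded c : 1 <= v (c - 1) -> coef_bounded (v (c - 1))^-1 (inv_poly c).
Proof.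
move=> hc j; have c0 : 0 < v (c - 1) := lt_le_trans ltr01 hc.
rewrite coef_poly; case: ifP => hj; last by rewrite vabs0 invr_ge0 vabs_ge0.
rewrite vabs_div [v (1 - _)]vabsC vabs_subX1 // ler_pdivrMr ?exprn_gt0 //.
rewrite -[X in _ <= _ * _ ^+ X](prednK N_gt0) exprS mulKf ?gt_eqF // vabsX.
apply: (@le_trans _ _ (v (c - 1) ^+ (N.-1 - j))).
  rewrite lerXn2r ?nnegrE ?vabs_ge0 // -[X in v X <= _](subrK 1).
  by rewrite vabsD_le // vabs1.
by rewrite ler_weXn2l // leq_subr.
Qed.

(** On $D^-(1,1)$ the denominator has constant absolute value $q$, so [P] has Gauss norm at most
    $eq$. On the roots of unity the fraction equals [P] times a product of [inv_poly], of norm at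
    most $q^{-1}$, and the mean of a polynomial is a sum of some of its coefficients. *)
Lemma mean_frac_bound (s : seq K) P e :
  (forall c, c \in s -> 1 <= v (c - 1)) ->
  (forall x, v (x - 1) < 1 -> v (P.[x] / \prod_(c <- s) (x - c)) <= e) ->
  v (N%:R^-1 * \sum_(i < N) z ^+ i * (P.[z ^+ i] / \prod_(c <- s) (z ^+ i - c))) <= e.
Proof.
move=> hs hP.
pose q := \prod_(c <- s) v (c - 1).
have q0 : 0 < q.
  rewrite /q big_seq; apply: (big_ind (fun x : R => 0 < x)) => // [x y|c /hs hc].
    exact: mulr_gt0.
  exact: lt_le_trans hc.
have hq x : v (x - 1) < 1 -> v (\prod_(c <- s) (x - c)) = q.
  move=> hx; rewrite vabs_prod /q; apply: eq_big_seq => c /hs hc.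
  rewrite [RHS]vabsC; apply: vdist_close; rewrite [X in _ < X]vabsC.
  exact: lt_le_trans hc.
have hT : coef_bounded (e * q) (P \Po ('X + 1)).
  apply: coef_bounded_sup => t ht; rewrite horner_comp !hornerE.
  have ht1 : v (t + 1 - 1) < 1 by rewrite addrK.
  by have := hP _ ht1; rewrite vabs_div hq // ler_pdivrMr.
have hPc : coef_bounded (e * q) P.
  have := coef_bounded_comp hT; rewrite -comp_polyA.
  by rewrite comp_polyD comp_polyX comp_polyC subrK comp_polyXr.
have hG : coef_bounded q^-1 (\prod_(c <- s) inv_poly c).
  rewrite /q big_seq [X in coef_bounded _ X]big_seq.
  elim/big_ind2: _ => [|a A b B hA hB|c /hs]; last exact: inv_poly_bounded.
    by rewrite invr1; apply: (coef_boundedX 0).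
  by rewrite invfM; apply: coef_boundedM.
have hF : coef_bounded e ('X^1 * (P * \prod_(c <- s) inv_poly c)).
  have := coef_boundedM (coef_boundedX 1) (coef_boundedM hPc hG).
  by rewrite mul1r mulfK // gt_eqF.
have -> : \sum_(i < N) z ^+ i * (P.[z ^+ i] / \prod_(c <- s) (z ^+ i - c)) =
   \sum_(i < N) ('X^1 * (P * \prod_(c <- s) inv_poly c)).[z ^+ i].
  apply: eq_bigr => i _; rewrite !hornerM hornerXn expr1 horner_prod; congr (_ * (_ * _)).
  rewrite -prodfV [RHS]big_seq big_seq; apply: eq_bigr => c /hs hc.
  by rewrite inv_polyE // exprAC (prim_expr_order hz) expr1n.
rewrite (mean_unity_poly p_prime hK hz (leqnn _)); apply: vabs_sum_le => // .
exact: le_trans (vabs_ge0 _) (hF 0%N).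
Qed.

End Mean.
End GaussNorm.

(** * Teichmueller representatives *)

Section Teichmuller.
Context {R : realType} {K : valuedFieldType R}.
Variable p : nat.
Hypotheses (p_prime : prime p) (p_odd : odd p) (hK : padic_like p K).
Notation v := (@vabs R K).
Notation omega := (@omega R K p).
Implicit Types (u w : K).

Lemma omegaP u : v u <= 1 ->
  v (u - omega u) < 1 /\ exists2 l, (0 < l)%N & omega u ^+ (p ^ l) = omega u.
Proof.
move=> hu; rewrite /Defs.omega; case: ifPn => [/eqP u1|un1]; last first.
  rewrite subr0 lt_neqAle un1 hu; split => //; exists 1%N => //.
  by rewrite expr0n expn_eq0 -leqn0 leqNgt prime_gt0.
have [n n0 hn] := pl_residue hK u1.
have [m cpm nm] := pfactor_coprime p_prime n0.
have hm : v (u ^+ m - 1) < 1.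
  apply: (@frobenius_iter_sub1 _ _ p p_prime p_odd hK (logn p n)).
    by rewrite vabsX u1 expr1n.
  by rewrite -exprM -nm.
have m0 : (0 < m)%N by case: m nm {cpm hm} => // n00; rewrite n00 in n0.
have [z hz] := prim_root_ex p_prime hK m0.
have [i hi] : exists i, v (u - z ^+ i) < 1.
  have [//|hn'] := pselect (exists i, v (u - z ^+ i) < 1).
  suff : 1 <= v (u ^+ m - 1) by rewrite leNgt hm.
  rewrite -(prod_unity u hz) vabs_prod.
  apply: le_trans (prod_ge_expr (d := 1) ler01 _); first by rewrite expr1n.
  by move=> i _; rewrite leNgt; apply/negP => h; apply: hn'; exists i.
set S := (X in xget 0 X).
have [[k ckp hk] hw] : S (xget 0 S).
  apply: xgetPex; exists (z ^+ i); split => //.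
  have zm : (z ^+ i) ^+ m = 1 by rewrite exprAC (prim_expr_order hz) expr1n.
  have [k hk km] := prim_order_exists m0 zm; exists k => //.
  by rewrite coprime_sym; exact: coprime_dvdr cpm.
(* For a root of unity of order $k$ prime to $p$, $p^{\varphi(k)} \equiv 1$ modulo $k$. *)
split => //; exists (totient k); first by rewrite totient_gt0 (prim_order_gt0 hk).
rewrite -(prim_expr_mod hk) (Euler_exp_totient _) ?(prim_expr_mod hk) ?expr1 //.
by rewrite coprime_sym.
Qed.

Lemma omega_le1 u : v u <= 1 -> v (omega u) <= 1.
Proof.
by move=> hu; rewrite -[omega u](subKr u) vabsB_le // ltW; have [] := omegaP hu.
Qed.

Lemma expp_fixed u l k : u ^+ (p ^ l) = u -> u ^+ (p ^ (l * k)) = u.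
Proof.
move=> h; elim: k => [|k IH]; first by rewrite muln0 expn0 expr1.
by rewrite mulnS expnD exprM h.
Qed.

(** Both representatives are fixed by arbitrarily high common powers $p^n$, under which close
    elements become arbitrarily close. *)
Lemma omega_close u u' : v u <= 1 -> v (u' - u) < 1 -> omega u' = omega u.
Proof.
move=> hu huu'; have hu' : v u' <= 1.
  by rewrite -(subrK u u') vabsD_le // ltW.
have [h [l l0 hl]] := omegaP hu; have [h' [l' l'0 hl']] := omegaP hu'.
have hww : v (omega u' - omega u) < 1.
  apply: (@vdist_lt _ _ u'); first by rewrite vabsC.
  exact: vdist_lt huu' h.
apply/eqP; rewrite -subr_eq0; apply/eqP/vabs_eq0_le => e e0.
have [N hN] := expp_close p_prime hK (omega_le1 hu') (omega_le1 hu) hww e0.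
have hNl : (N <= l * l' * N)%N by rewrite leq_pmull // muln_gt0 l0.
by have := hN _ hNl; rewrite -mulnA (expp_fixed _ hl) mulnCA (expp_fixed _ hl') => /ltW.
Qed.

Variables (alpha l : nat).
Hypothesis l_gt0 : (0 < l)%N.
(** The path sequence of $\Phi_\alpha$ with $\lambda = l$. *)
Definition levels k := (alpha + l * k)%N.

Lemma levels_ge k : (k <= levels k)%N.
Proof. by rewrite /levels (leq_trans (leq_pmull k l_gt0)) // leq_addl. Qed.

Lemma levels_pow_ge k : (k <= p ^ levels k)%N.
Proof. exact: leq_trans (levels_ge k) (ltnW (ltn_expl _ (prime_gt1 p_prime))). Qed.

(** Raised to high $p$-powers, $w$ and $\omega(u)$ approach each other, while the powers of
    $\omega(u)$ along [levels] are constant. *)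
Lemma tends_omega u w : v u <= 1 -> v (w - u) < 1 -> omega u ^+ (p ^ l) = omega u ->
  tends (fun k => w ^+ (p ^ levels k)) (omega u ^+ (p ^ alpha)).
Proof.
move=> hu hwu hl e e0.
have hw : v w <= 1 by rewrite -(subrK u w) vabsD_le // ltW.
have hwo : v (w - omega u) < 1 by apply: vdist_lt hwu _; have [] := omegaP hu.
have [N hN] := expp_close p_prime hK hw (omega_le1 hu) hwo e0.
exists N => k Nk; have := hN _ (leq_trans Nk (levels_ge k)).
by rewrite {2}/levels addnC expnD exprM (expp_fixed _ hl).
Qed.

Lemma vabs_1subXp u n : v u <= 1 -> v (1 - u) = 1 -> v (1 - u ^+ (p ^ n)) = 1.
Proof.
move=> hu h1; apply/le_anti; rewrite vabsB_le ?vabs1 ?vabsX ?exprn_ile1 ?vabs_ge0 //=.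
rewrite leNgt vabsC; apply/negP => /(frobenius_iter_sub1 p_prime p_odd hK hu).
by rewrite vabsC h1 ltxx.
Qed.

Lemma vabs_1sub_omega u : v u <= 1 -> v (1 - u) = 1 ->
  v (1 - omega u ^+ (p ^ alpha)) = 1.
Proof.
move=> hu h1; apply: vabs_1subXp; first exact: omega_le1.
by rewrite -h1 ![v (1 - _)]vabsC; apply: vdist_close; rewrite vabsC [X in _ < X]vabsC h1;
  have [] := omegaP hu.
Qed.

(** All the denominators have absolute value 1, so inversion preserves their distances. *)
Lemma tends_pole_in u w : v u <= 1 -> v (1 - u) = 1 -> v (w - u) < 1 ->
  omega u ^+ (p ^ l) = omega u ->
  tends (fun k => (1 - w ^+ (p ^ levels k))^-1) (1 - omega u ^+ (p ^ alpha))^-1.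
Proof.
move=> hu h1 hwu hl e e0; have [N hN] := tends_omega hu hwu hl e0.
have hw : v w <= 1 by rewrite -(subrK u w) vabsD_le // ltW.
have hw1 : v (1 - w) = 1.
  by rewrite -h1 ![v (1 - _)]vabsC; apply: vdist_close; rewrite [X in _ < X]vabsC h1.
have neq0 x : v x = 1 -> x != 0.
  by move=> hx; apply: contra_eq_neq hx => ->; rewrite vabs0 eq_sym oner_eq0.
exists N => k /hN; set x := w ^+ _; set y := _ ^+ (p ^ alpha).
have hx : v (1 - x) = 1 by apply: vabs_1subXp.
have hy : v (1 - y) = 1 by apply: vabs_1sub_omega.
have -> : (1 - x)^-1 - (1 - y)^-1 = (x - y) / ((1 - x) * (1 - y)).
  by field; rewrite !neq0.
by rewrite vabs_div vabsM hx hy mulr1 divr1.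
Qed.

Lemma tends_pole_out w : 1 < v w -> tends (fun k => (1 - w ^+ (p ^ levels k))^-1) 0.
Proof.
move=> hw e e0; have w0 : 0 < v w := lt_trans ltr01 hw.
have [N hN] : exists N, forall n, (N <= n)%N -> (v w)^-1 ^+ n < e.
  by apply: expr_small; rewrite ?invr_ge0 ?vabs_ge0 ?invf_lt1.
exists N => k Nk; have Nk' := leq_trans Nk (levels_pow_ge k).
have pos : (0 < p ^ levels k)%N by rewrite expn_gt0 prime_gt0.
rewrite subr0 vabsV vabsDl_eq ?vabsN ?vabsX ?vabs1 ?exprn_egt1 -?lt0n //.
by rewrite -exprVn hN.
Qed.

End Teichmuller.

(** * Density of partial fractions *)

Section RationalApproximation.
Context {R : realType} {K : valuedFieldType R}.
Notation v := (@vabs R K).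
Implicit Types (s : seq K) (f g h : K -> K) (P : {poly K}) (D : set K).

(** Multiple poles are repeated in [s]; the leading coefficient of the denominator is absorbed in
    [P]. *)
Definition rational_fun s P (x : K) : K := P.[x] / \prod_(c <- s) (x - c).

Definition poles_off D s := forall c, c \in s -> ~ D c.

Definition rat_approximable D f := forall e : R, 0 < e -> exists s P,
  poles_off D s /\ forall x, D x -> v (f x - rational_fun s P x) <= e.

(** Only simple poles occur; [s] merely lists where they may lie. *)
Inductive partial_fraction s : (K -> K) -> Prop :=
  | PF_poly P : partial_fraction s (horner P)
  | PF_pole c e : c \in s -> partial_fraction s (fun x => e / (x - c))
  | PF_add g h : partial_fraction s g -> partial_fraction s h ->
      partial_fraction s (fun x => g x + h x).

Lemma poles_off_neq D s x c : poles_off D s -> D x -> c \in s -> x - c != 0.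
Proof. by move=> hs Dx cs; rewrite subr_eq0; apply: contra_not_neq (hs c cs) => <-. Qed.

Lemma poles_off_prod D s x : poles_off D s -> D x -> \prod_(c <- s) (x - c) != 0.
Proof.
by move=> hs Dx; rewrite prodf_seq_neq0; apply/allP => c /(poles_off_neq hs Dx).
Qed.

Lemma poles_off_cat D s s' : poles_off D s -> poles_off D s' -> poles_off D (s ++ s').
Proof. by move=> hs hs' c; rewrite mem_cat => /orP[/hs|/hs']. Qed.

Lemma horner_prod_XsubC s x : (\prod_(c <- s) ('X - c%:P)).[x] = \prod_(c <- s) (x - c).
Proof. by rewrite horner_prod; apply: eq_bigr => c _; rewrite hornerXsubC. Qed.

Lemma rational_funD D s s' P P' : poles_off D s -> poles_off D s' ->
  forall x, D x -> rational_fun (s ++ s')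
    (P * \prod_(c <- s') ('X - c%:P) + P' * \prod_(c <- s) ('X - c%:P)) x
  = rational_fun s P x + rational_fun s' P' x.
Proof.
move=> hs hs' x Dx; rewrite /rational_fun big_cat /= hornerD !hornerM !horner_prod_XsubC.
have := poles_off_prod hs Dx; have := poles_off_prod hs' Dx.
by move=> h1 h2; field; rewrite h1 h2.
Qed.

Lemma rat_approximableB D f g : rat_approximable D f -> rat_approximable D g ->
  rat_approximable D (fun x => f x - g x).
Proof.
move=> hf hg e e0; have [s [P [hs hP]]] := hf e e0.
have [s' [P' [hs' hP']]] := hg e e0.
exists (s ++ s'), (P * \prod_(c <- s') ('X - c%:P) + - P' * \prod_(c <- s) ('X - c%:P)).
split; first exact: poles_off_cat.
move=> x Dx; rewrite (rational_funD _ _ hs hs') //.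
have -> : rational_fun s' (- P') x = - rational_fun s' P' x.
  by rewrite /rational_fun hornerN mulNr.
have -> : f x - g x - (rational_fun s P x - rational_fun s' P' x)
  = (f x - rational_fun s P x) - (g x - rational_fun s' P' x) by ring.
by apply: vabsB_le; [apply: hP|apply: hP'].
Qed.

Lemma rational_partial_fraction D s g : poles_off D s -> partial_fraction s g ->
  exists s' P, poles_off D s' /\ forall x, D x -> g x = rational_fun s' P x.
Proof.
move=> hs; elim=> {g} [P|c e cs|g h _ [s1 [P1 [h1 hP1]]] _ [s2 [P2 [h2 hP2]]]].
- by exists [::], P; split => // x _; rewrite /rational_fun big_nil divr1.
- exists [:: c], e%:P; split => [d|x _]; first by rewrite inE => /eqP ->; apply: hs.
  by rewrite /rational_fun big_seq1 hornerC.
- exists (s1 ++ s2), (P1 * \prod_(c <- s2) ('X - c%:P) + P2 * \prod_(c <- s1) ('X - c%:P)).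
  split; first exact: poles_off_cat.
  by move=> x Dx; rewrite (rational_funD _ _ h1 h2) // hP1 // hP2.
Qed.

Lemma rat_approximable_partial_fraction D s g : poles_off D s -> partial_fraction s g ->
  rat_approximable D g.
Proof.
move=> hs hg e e0; have [s' [P [hs' hP]]] := rational_partial_fraction hs hg.
by exists s', P; split => // x Dx; rewrite hP // subrr vabs0 ltW.
Qed.

Lemma krasner_rat_approximable D f : GRing.closed_field_axiom K -> D !=set0 ->
  krasner_analytic D f -> rat_approximable D f.
Proof.
move=> cl [x0 Dx0] [P [Q [hQ hf]]] e e0; have [N hN] := hf e e0.
have [s hs] := closed_field_split cl (Q N).
(* A point of [D] is what excludes the zero denominator. *)
have l0 : lead_coef (Q N) != 0.
  by rewrite lead_coef_eq0; apply: contra_neq (hQ N x0 Dx0) => ->; rewrite horner0.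
have hsx x : (Q N).[x] = lead_coef (Q N) * \prod_(c <- s) (x - c).
  by rewrite {1}hs hornerZ horner_prod_XsubC.
exists s, ((lead_coef (Q N))^-1 *: P N); split => [c cs Dc|x Dx].
  have : root (\prod_(c <- s) ('X - c%:P)) c by rewrite root_prod_XsubC.
  rewrite rootE horner_prod_XsubC => /eqP h0.
  by move/eqP: (hQ N c Dc); apply; rewrite hsx h0 mulr0.
apply/ltW; have := hN N (leqnn _) x Dx; rewrite /rational_fun hornerZ hsx.
by rewrite invfM mulrCA mulrA.
Qed.

(** Dividing by $x - d$ uses $P = Q \cdot (x-d) + P(d)$ and $\frac{1}{(x-c)(x-d)} =
    \frac{1}{c-d}\left(\frac{1}{x-c} - \frac{1}{x-d}\right)$. A new [d] keeps the poles simple. *)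
Lemma partial_fraction_div s d g : d \notin s -> partial_fraction s g ->
  exists2 h, partial_fraction (d :: s) h &
    forall x, x != d -> x \notin s -> h x = g x / (x - d).
Proof.
move=> ds; elim=> {g} [P|c e cs|g1 g2 _ [h1 hh1 e1] _ [h2 hh2 e2]].
- have /factor_theorem[Q hQ] : root (P - P.[d]%:P) d.
    by rewrite rootE !hornerE subrr.
  exists (fun x => Q.[x] + P.[d] / (x - d)).
    by apply: PF_add; [apply: PF_poly|apply: PF_pole; rewrite mem_head].
  move=> x xd _; have xd0 : x - d != 0 by rewrite subr_eq0.
  have -> : P.[x] = Q.[x] * (x - d) + P.[d].
    by have := congr1 (horner^~ x) hQ; rewrite !hornerE => <-; rewrite subrK.
  by field.
- exists (fun x => (e / (c - d)) / (x - c) + (- (e / (c - d))) / (x - d)).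
    by apply: PF_add; apply: PF_pole; rewrite inE ?cs ?eqxx ?orbT.
  move=> x xd xs; have xd0 : x - d != 0 by rewrite subr_eq0.
  have xc0 : x - c != 0 by rewrite subr_eq0; apply: contraNneq xs => ->.
  have cd0 : c - d != 0 by rewrite subr_eq0; apply: contraNneq ds => <-.
  by field; rewrite xd0 xc0 cd0.
- exists (fun x => h1 x + h2 x); first exact: PF_add.
  by move=> x xd xs; rewrite e1 // e2 // mulrDl.
Qed.

Lemma avoid_seq s d (e : R) : (forall e : R, 0 < e -> exists2 t : K, t != 0 & v t < e) ->
  0 < e -> exists2 d', v (d' - d) < e & d' \notin s.
Proof.
move=> small e0.
have [e' [e'0 e'e he']] : exists e', [/\ 0 < e', e' <= e &
    forall c, c \in s -> c != d -> e' <= v (c - d)].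
  elim: s => [|c s [e' [e'0 e'e he']]]; first by exists e.
  have [cd|cd] := eqVneq c d.
    by exists e'; split => // c'; rewrite inE => /predU1P[-> /eqP //|]; apply: he'.
  exists (Num.min e' (v (c - d))); split.
  - by rewrite lt_min e'0 vabs_gt0 // subr_eq0.
  - by rewrite ge_min e'e.
  - move=> c'; rewrite inE => /predU1P[-> _|/he' h /h h']; first by rewrite ge_min lexx orbT.
    by rewrite ge_min h'.
have [t t0 te] := small _ e'0; exists (d + t).
  by rewrite addrAC subrr add0r (lt_le_trans te).
apply/negP => /he'; rewrite addrAC subrr add0r leNgt te => h.
suff /h : d + t != d by [].
by rewrite -subr_eq0 addrAC subrr add0r.
Qed.

Section ClosedBounded.
Variable D : set K.
Hypothesis D_bounded : exists B, forall x, D x -> v x <= B.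
Hypothesis D_closed : forall c, ~ D c ->
  exists2 k, 0 < k & forall x, D x -> k <= v (x - c).
Hypothesis K_small : forall e : R, 0 < e -> exists2 t : K, t != 0 & v t < e.

Lemma partial_fraction_bounded s g : poles_off D s -> partial_fraction s g ->
  exists2 M, 0 < M & forall x, D x -> v (g x) <= M.
Proof.
move=> hs; elim=> {g} [P|c e cs|g h _ [M M0 hM] _ [M' M'0 hM']].
- have [B hB] := D_bounded; have [M M0 hM] := vabs_horner_lip P (Num.max B 0).
  exists (Num.max (v P.[0]) (M * Num.max B 0) + 1).
    by rewrite ltr_wpDl // le_max vabs_ge0.
  move=> x Dx; apply: (@le_trans _ _ (Num.max (v P.[0]) (M * Num.max B 0))); last by rewrite lerDl.
  rewrite -(subrK P.[0] P.[x]); apply: vabsD_le; rewrite le_max ?lexx //.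
  apply/orP; right; have hx : v x <= Num.max B 0 by rewrite le_max hB.
  apply: le_trans (hM _ _ hx _) _; first by rewrite vabs0 le_max lexx orbT.
  by rewrite subr0 ler_wpM2l // ltW.
- have [k k0 hk] := D_closed (hs c cs); exists (v e / k + 1).
    by rewrite ltr_wpDl // divr_ge0 ?vabs_ge0 ?ltW.
  move=> x Dx; apply: (@le_trans _ _ (v e / k)); last by rewrite lerDl.
  by rewrite vabs_div ler_wpM2l ?vabs_ge0 // lef_pV2 ?posrE ?hk // (lt_le_trans k0) ?hk.
- exists (Num.max M M'); first by rewrite lt_max M0.
  by move=> x Dx; apply: vabsD_le; rewrite le_max ?hM ?hM' ?orbT.
Qed.

(* A pole that would become multiple is first moved slightly. *)
Lemma rational_approx_partial_fraction s P : poles_off D s -> forall e : R, 0 < e ->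
  exists s' g, [/\ poles_off D s', partial_fraction s' g &
    forall x, D x -> v (rational_fun s P x - g x) <= e].
Proof.
elim: s => [|d s IH] hs e e0.
  exists [::], (horner P); split => //; first exact: PF_poly.
  by move=> x _; rewrite /rational_fun big_nil divr1 subrr vabs0 ltW.
have Dd : ~ D d by apply: hs; rewrite mem_head.
have [k k0 hk] := D_closed Dd.
have hs' : poles_off D s by move=> c cs; apply: hs; rewrite inE cs orbT.
(* Division by $x - d$ costs at most a factor $1/k$ on [D]. *)
have [s1 [g [hs1 hg hgx]]] := IH hs' (e * k) (mulr_gt0 e0 k0).
have [M M0 hM] := partial_fraction_bounded hs1 hg.
(* The first bound gives $|x - d'| = |x - d|$ on [D] and keeps $d'$ outside [D]; the second makes
   the error $M|d - d'|/k^2$ at most $e$. *)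
have kk : 0 < Num.min k (e * (k * k) / M) by rewrite lt_min k0 !(divr_gt0, mulr_gt0).
have [d' dd' d's1] := avoid_seq s1 d K_small kk.
move: dd'; rewrite lt_min => /andP[dk dM].
have hd' x : D x -> v (x - d') = v (x - d).
  move=> Dx; rewrite vabsC [RHS]vabsC; apply: vdist_close.
  by rewrite [X in _ < X]vabsC (lt_le_trans dk) // hk.
have Dd' : ~ D d'.
  by move=> Dd'; have := hk _ (Dd'); rewrite leNgt dk.
have [h hh hhx] := partial_fraction_div d's1 hg.
have hs2 : poles_off D (d' :: s1) by move=> c; rewrite inE => /predU1P[->|/hs1].
exists (d' :: s1), h; split => // x Dx.
have xd'0 : x - d' != 0 by apply: (poles_off_neq hs2 Dx); rewrite mem_head.
have xd0 : x - d != 0 by apply: (poles_off_neq hs Dx); rewrite mem_head.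
have xs1 : x \notin s1 by apply/negP => /hs1; apply.
rewrite hhx // -1?subr_eq0 //.
have -> : rational_fun (d :: s) P x = rational_fun s P x / (x - d).
  by rewrite /rational_fun big_cons invfM mulrA mulrAC.
have -> : rational_fun s P x / (x - d) - g x / (x - d') =
   (rational_fun s P x - g x) / (x - d) + g x * (d - d') / ((x - d) * (x - d')).
  by field; rewrite xd'0 xd0.
have kx := hk _ Dx; have kx0 := lt_le_trans k0 kx.
apply: vabsD_le; rewrite !vabs_div ler_pdivrMr ?vabsM ?(hd' x Dx) ?mulr_gt0 //.
  by apply: le_trans (hgx _ Dx) _; rewrite ler_pM2l.
apply: (@le_trans _ _ (e * (k * k))); last by rewrite ler_pM2l // ler_pM ?(ltW k0).
apply: (@le_trans _ _ (M * (e * (k * k) / M))).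
  by apply: ler_pM; rewrite ?vabs_ge0 ?hM // vabsC ltW.
by rewrite mulrC mulfVK // gt_eqF.
Qed.

Lemma approx_partial_fraction f : rat_approximable D f -> forall e : R, 0 < e ->
  exists s g, [/\ poles_off D s, partial_fraction s g &
    forall x, D x -> v (f x - g x) <= e].
Proof.
move=> hf e e0; have [s [P [hs hP]]] := hf e e0.
have [s' [g [hs' hg hgx]]] := rational_approx_partial_fraction P hs e0.
exists s', g; split => // x Dx; apply: (vdist_le (hP x Dx)); exact: hgx.
Qed.

End ClosedBounded.
End RationalApproximation.

(** * Means along an arc *)

Section RootMean.
Context {R : realType} {K : valuedFieldType R}.
Variable p : nat.
Hypotheses (p_prime : prime p) (p_odd : odd p) (hK : padic_like p K).
Notation v := (@vabs R K).
Implicit Types (a b c w x : K) (f g h : K -> K) (s : seq K) (P : {poly K}).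

(** Indexing the roots of unity by powers of [z] makes the mean an ordinary finite sum; $x - a =
    (b-a)\zeta$ supplies the outer factor. *)
Lemma root_meanE n z a b f : n.-primitive_root z ->
  root_mean n a b f =
  (b - a) * (n%:R^-1 * \sum_(i < n) z ^+ i * f (a + (b - a) * z ^+ i)).
Proof.
move=> hz; have n0 := prim_order_gt0 hz.
pose r := [seq z ^+ i | i <- index_iota 0 n].
have ur : uniq r.
  rewrite map_inj_in_uniq ?iota_uniq // => i j; rewrite !mem_index_iota /= => hi hj /eqP.
  by rewrite (eq_prim_root_expr hz) !modn_small // => /eqP.
rewrite /root_mean; have -> : [set zeta : K | zeta ^+ n = 1] = [set` r].
  apply/seteqP; split => x /=.
    move=> /(prim_rootP hz)[i ->]; apply/mapP; exists (val i) => //.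
    by rewrite mem_index_iota /=.
  by move=> /mapP[i _ ->]; rewrite exprAC (prim_expr_order hz) expr1n.
rewrite -fsbig_seq // big_map mulrCA; congr (_ * _).
rewrite mulr_sumr big_mkord; apply: eq_bigr => i _.
by rewrite addrC addKr mulrA.
Qed.

Lemma root_mean_ext n a b f g : (0 < n)%N ->
  (forall x, x ^+ n = 1 -> f (a + (b - a) * x) = g (a + (b - a) * x)) ->
  root_mean n a b f = root_mean n a b g.
Proof.
move=> n0 fg; have [z hz] := prim_root_ex p_prime hK n0.
rewrite !(root_meanE _ _ _ hz); congr (_ * (_ * _)); apply: eq_bigr => i _.
by rewrite fg // exprAC (prim_expr_order hz) expr1n.
Qed.

Lemma root_meanD n a b f g : (0 < n)%N ->
  root_mean n a b (fun x => f x + g x) = root_mean n a b f + root_mean n a b g.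
Proof.
move=> n0; have [z hz] := prim_root_ex p_prime hK n0.
rewrite !(root_meanE _ _ _ hz) -!mulrDr -big_split /=; congr (_ * (_ * _)).
by apply: eq_bigr => i _; rewrite mulrDr.
Qed.

Lemma root_meanZ n a b k f : (0 < n)%N ->
  root_mean n a b (fun x => k * f x) = k * root_mean n a b f.
Proof.
move=> n0; have [z hz] := prim_root_ex p_prime hK n0.
rewrite !(root_meanE _ _ _ hz) [RHS]mulrCA; congr (_ * _).
rewrite [RHS]mulrCA; congr (_ * _); rewrite mulr_sumr.
by apply: eq_bigr => i _; rewrite mulrCA.
Qed.

Lemma root_meanB n a b f g : (0 < n)%N ->
  root_mean n a b (fun x => f x - g x) = root_mean n a b f - root_mean n a b g.
Proof.
move=> n0; rewrite -mulN1r -root_meanZ // -root_meanD //; congr root_mean.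
by apply/funext => x; rewrite mulN1r.
Qed.

(** The weight $x - a$ contributes a factor $X$, so there is no constant term, and the degree is too
    small for any other index divisible by [n]. *)
Lemma root_mean_poly n a b P : (size (P \Po ((b - a) *: 'X + a%:P)) < n)%N ->
  root_mean n a b (horner P) = 0.
Proof.
set Q := _ \Po _ => hn.
have n0 : (0 < n)%N := leq_ltn_trans (leq0n _) hn.
have [z hz] := prim_root_ex p_prime hK n0.
rewrite (root_meanE _ _ _ hz).
have -> : \sum_(i < n) z ^+ i * P.[a + (b - a) * z ^+ i] = \sum_(i < n) (Q * 'X).[z ^+ i].
  by apply: eq_bigr => i _; rewrite hornerMX /Q horner_comp !hornerE mulrC [a + _]addrC.
have sQ : (size (Q * 'X)%R <= n)%N by rewrite (leq_trans (size_polyMleq _ _)) // size_polyX addn2.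
rewrite (mean_unity_poly_small p_prime hK hz) ?(leqW sQ) //.
by rewrite coefMX /= add0r [_`_n]nth_default // mulr0.
Qed.

(** * Bounds and explicit means on a single arc *)

Section Arc.
Variables a b : K.
Hypothesis ab : a != b.

Let r_gt0 : 0 < v (b - a).
Proof. by rewrite vabs_gt0 // subr_eq0 eq_sym. Qed.

Let ba0 : b - a != 0.
Proof. by rewrite subr_eq0 eq_sym. Qed.

(** The coordinate $(x-a)/(b-a)$ carries the arc to $D^-(1,1)$. *)
Lemma padic_arcE x : padic_arc a b x <-> v ((x - a) / (b - a) - 1) < 1.
Proof.
have -> : (x - a) / (b - a) - 1 = (x - b) / (b - a) by field.
by rewrite vabs_div ltr_pdivrMr // mul1r [v (b - a)]vabsC.
Qed.

Let arc_coordK x : (a + (b - a) * x - a) / (b - a) = x.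
Proof. by field. Qed.

Lemma padic_arc_root n x : x ^+ (p ^ n) = 1 -> padic_arc a b (a + (b - a) * x).
Proof.
move=> hx; apply/padic_arcE; rewrite arc_coordK.
exact: (unity_close p_prime p_odd hK hx).
Qed.

(** Division by $p^n$ may cost a factor $1/|p^n|$; the bound is meant for errors already scaled by
    $|p^n|$. *)
Lemma root_mean_trivial_bound n f (e : R) :
  (forall x, padic_arc a b x -> v (f x) <= e) ->
  v (root_mean (p ^ n) a b f) <= v (b - a) * e / v (p ^ n)%:R.
Proof.
move=> hf; have n0 : (0 < p ^ n)%N by rewrite expn_gt0 prime_gt0.
have [z hz] := prim_root_ex p_prime hK n0.
rewrite (root_meanE _ _ _ hz) !vabsM vabsV -mulrA ler_pM2l // mulrC.
rewrite ler_wpM2r ?invr_ge0 ?vabs_ge0 //.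
have zi i : (z ^+ i) ^+ (p ^ n) = 1 by rewrite exprAC (prim_expr_order hz) expr1n.
have e0 : 0 <= e.
  apply: le_trans (hf b _); rewrite ?vabs_ge0 // /padic_arc /Dminus /= subrr vabs0.
  by rewrite vabsC.
apply: vabs_sum_le => // i _.
have hzi : v (z ^+ i) = 1.
  have /eqP : v (z ^+ i) ^+ (p ^ n) = 1 by rewrite -vabsX zi vabs1.
  by rewrite pexpr_eq1 ?vabs_ge0 // => /eqP.
by rewrite vabsM hzi mul1r hf //; apply: (@padic_arc_root n).
Qed.

Lemma root_mean_rational_bound n s P (e : R) :
  (forall c, c \in s -> ~ padic_arc a b c) ->
  (forall x, padic_arc a b x -> v (rational_fun s P x) <= e) ->
  v (root_mean (p ^ n) a b (rational_fun s P)) <= v (b - a) * e.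
Proof.
move=> hs hP; have n0 : (0 < p ^ n)%N by rewrite expn_gt0 prime_gt0.
have [z hz] := prim_root_ex p_prime hK n0.
pose s1 := [seq (c - a) / (b - a) | c <- s].
pose P1 := (b - a) ^- (size s) *: (P \Po ((b - a) *: 'X + a%:P)).
have E y : rational_fun s P (a + (b - a) * y) = P1.[y] / \prod_(c <- s1) (y - c).
  rewrite /rational_fun hornerZ horner_comp !hornerE [_ + a]addrC.
  have -> : \prod_(c <- s) (a + (b - a) * y - c) =
      (b - a) ^+ size s * \prod_(c <- s1) (y - c).
    rewrite /s1 big_map; elim: s {hs hP s1 P1} => [|c s IH]; first by rewrite !big_nil mulr1.
    rewrite !big_cons IH /= exprS; set q := \prod_(_ <- _) _; set t := _ ^+ _.
    by field.
  by rewrite invfM mulrCA mulrA.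
rewrite (root_meanE _ _ _ hz) vabsM ler_pM2l //.
under eq_bigr do rewrite E.
apply: (mean_frac_bound p_prime p_odd hK hz) => [_ /mapP[c cs ->]|y hy].
  by rewrite leNgt; apply/negP => /padic_arcE; apply: hs.
rewrite -E; apply/hP/padic_arcE.
by rewrite arc_coordK.
Qed.

(** For a fixed [n], split [f] into a rational function and an error of size $e|p^n|$. The sharp
    bound applies to the first and the trivial one to the second; $|x - z_0| \ge |b - a|$ on the
    arc. *)
Lemma root_mean_approx_bound n (D : set K) f z0 (e : R) :
  padic_arc a b `<=` D -> rat_approximable D f -> ~ padic_arc a b z0 -> 0 < e ->
  (forall x, D x -> v (f x) <= e) ->
  v (root_mean (p ^ n) a b (fun x => f x / (x - z0))) <= e.
Proof.
move=> sD hf hz0 e0 hfe; have n0 : (0 < p ^ n)%N by rewrite expn_gt0 prime_gt0.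
have nK : 0 < v (p ^ n)%:R by rewrite vabs_gt0 // (natr_neq0 p_prime (pl_p hK)).
have [s [P [hs hP]]] := hf (e * v (p ^ n)%:R) (mulr_gt0 e0 nK).
have hz x : padic_arc a b x -> v (x - z0) >= v (b - a).
  move=> hx; have hz0' : v (b - a) <= v (z0 - b).
    by rewrite leNgt; apply/negP => h; apply: hz0; rewrite /padic_arc /Dminus /= [v (a - b)]vabsC.
  rewrite [v (z0 - b)]vabsC in hz0'; rewrite (@vdist_close _ _ _ b) //; apply: lt_le_trans hz0'.
  by move: hx; rewrite /padic_arc /Dminus /= [v (a - b)]vabsC.
pose g := rational_fun (z0 :: s) P.
have gE x : g x = rational_fun s P x / (x - z0).
  by rewrite /g /rational_fun big_cons invfM mulrA mulrAC.
have -> : root_mean (p ^ n) a b (fun x => f x / (x - z0)) =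
   root_mean (p ^ n) a b g +
   root_mean (p ^ n) a b (fun x => (f x - rational_fun s P x) / (x - z0)).
  rewrite -root_meanD //; congr root_mean; apply/funext => x.
  by rewrite gE -mulrDl; congr (_ / _); rewrite addrC subrK.
have bnd x (y : K) d : padic_arc a b x -> v y <= d -> v (y / (x - z0)) <= d / v (b - a).
  move=> /hz hx hy; rewrite vabs_div ler_pM ?vabs_ge0 ?invr_ge0 ?vabs_ge0 //.
  by rewrite lef_pV2 // posrE // (lt_le_trans r_gt0).
apply: vabsD_le.
  have -> : e = v (b - a) * (e / v (b - a)) by rewrite mulrC mulfVK // gt_eqF.
  apply: root_mean_rational_bound => [c|x hx].
    by rewrite inE => /predU1P[-> //|/hs Dc /sD].
  rewrite -/(g x) gE; apply: bnd => //.
  rewrite -(subKr (f x) (rational_fun s P x)) vabsB_le ?hfe //; first exact: sD.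
  apply: le_trans (hP _ (sD _ hx)) _.
  by rewrite ler_piMr ?(ltW e0) // vabs_natr_le1.
apply: le_trans (root_mean_trivial_bound (e := e * v (p ^ n)%:R / v (b - a)) n _) _.
  by move=> x hx; apply: bnd => //; apply: hP; apply: sD.
rewrite [v (b - a) * _]mulrC mulfVK ?gt_eqF // mulfK // ?gt_eqF //.
Qed.

(** The interpolating polynomial times $X$ has degree at most $N = p^n$ and no constant term, so the
    mean is its coefficient of $X^N$, which is $1/(1 - c^N)$. *)
Lemma root_mean_pole n w : ~ padic_arc a b w ->
  root_mean (p ^ n) a b (fun x => (x - w)^-1) = (1 - ((w - a) / (b - a)) ^+ (p ^ n))^-1.
Proof.
move=> hw; have n0 : (0 < p ^ n)%N by rewrite expn_gt0 prime_gt0.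
have [z hz] := prim_root_ex p_prime hK n0.
rewrite (root_meanE _ _ _ hz); set c := (w - a) / (b - a).
have hc : 1 <= v (c - 1) by rewrite leNgt; apply/negP => /padic_arcE.
have zi i : (z ^+ i) ^+ (p ^ n) = 1 by rewrite exprAC (prim_expr_order hz) expr1n.
have -> : \sum_(i < p ^ n) z ^+ i / (a + (b - a) * z ^+ i - w) =
   (b - a)^-1 * \sum_(i < p ^ n) (inv_poly p n c * 'X).[z ^+ i].
  rewrite mulr_sumr; apply: eq_bigr => i _; rewrite hornerMX.
  rewrite (inv_polyE p_prime p_odd hK hz hc (zi i)).
  have -> : a + (b - a) * z ^+ i - w = (b - a) * (z ^+ i - c) by rewrite /c; field.
  by rewrite invfM mulrCA [z ^+ i * _]mulrC.
rewrite mulrCA mulVKf //.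
have sQ : (size (inv_poly p n c * 'X)%R <= (p ^ n).+1)%N.
  apply: leq_trans (size_polyMleq _ _) _; rewrite size_polyX addn2 /= ltnS.
  exact: size_poly.
rewrite (mean_unity_poly_small p_prime hK hz sQ) !coefMX /= add0r.
rewrite gtn_eqF // coef_poly prednK // leqnn subnn expr0 mul1r //.
Qed.

End Arc.
End RootMean.

(** * Simultaneous limits along finitely many arcs *)

Lemma big_option (V : nmodType) (I : finType) (F : option I -> V) :
  \sum_(o : option I) F o = F None + \sum_i F (Some i).
Proof.
rewrite (bigD1 None) //=; congr (_ + _).
rewrite (reindex_omap Some id) /=; last by case.
by apply: eq_bigl => i; rewrite eqxx.
Qed.

Section ArcFamily.
Context {R : realType} {K : valuedFieldType R}.
Variable p : nat.
Hypotheses (p_prime : prime p) (p_odd : odd p) (hK : padic_like p K).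
Notation v := (@vabs R K).
Variables (alpha l : nat).
Hypothesis l_gt0 : (0 < l)%N.
Variables (I : finType) (a b : I -> K) (D : set K) (z : K).
Hypothesis ab : forall i, a i != b i.
Hypothesis arcD : forall i, padic_arc (a i) (b i) `<=` D.
Hypothesis z_arc : forall i, ~ padic_arc (a i) (b i) z.
Hypothesis Dz : D z.
Variables (wt : I -> K) (c0 : K).

Let T i k f := root_mean (p ^ levels alpha l k) (a i) (b i) f.

Hypothesis pole_limits : forall w, w = z \/ ~ D w -> exists L : I -> K,
  (forall i, tends (fun k => T i k (fun x => (x - w)^-1)) (L i)) /\
  \sum_i wt i * L i = if w == z then c0 else 0.

Let Tgt0 k : (0 < p ^ levels alpha l k)%N.
Proof. by rewrite expn_gt0 prime_gt0. Qed.

Let T_ext i k f g : (forall x, D x -> x != z -> f x = g x) -> T i k f = T i k g.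
Proof.
move=> fg; apply: (root_mean_ext p_prime hK) => // x hx.
have harc := padic_arc_root p_prime p_odd hK (ab i) hx.
apply: fg; first exact: arcD harc.
by apply: contra_not_neq (@z_arc i) => <-.
Qed.

(** Splitting off the pole at [z] reduces $g(x)/(x-z)$ to fractions $1/(x-w)$ with $w = z$ or $w$
    off [D], and to polynomials, whose means are eventually 0. *)
Lemma family_partial_fraction s g : poles_off D s -> partial_fraction s g ->
  exists L : I -> K, (forall i, tends (fun k => T i k (fun x => g x / (x - z))) (L i)) /\
    \sum_i wt i * L i = c0 * g z.
Proof.
have [Lz [hLz sLz]] := pole_limits (or_introl (erefl z)); rewrite eqxx in sLz.
move=> hs; elim=> {g} [P|c e cs|g h _ [L [hL sL]] _ [L' [hL' sL']]].
- have /factor_theorem[Q hQ] : root (P - P.[z]%:P) z.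
    by rewrite rootE !hornerE subrr.
  exists (fun i => 0 + P.[z] * Lz i); split => [i|].
    have T0 : tends (fun k => T i k (horner Q)) 0.
      apply: (tends_ext _ (tends_cst 0)).
      exists (size (Q \Po ((b i - a i) *: 'X + (a i)%:P))).+1 => k hk.
      rewrite /T (root_mean_poly p_prime hK) //; apply: leq_trans hk _.
      exact: levels_pow_ge.
    apply: tends_ext (tendsD T0 (tendsZ P.[z] (hLz i))); exists 0%N => k _.
    rewrite -(root_meanZ p_prime hK) // -(root_meanD p_prime hK) //.
    apply: T_ext => x _ xz; have xz0 : x - z != 0 by rewrite subr_eq0.
    have -> : P.[x] = Q.[x] * (x - z) + P.[z].
      by have := congr1 (horner^~ x) hQ; rewrite !hornerE => <-; rewrite subrK.
    by field.
  rewrite -sLz mulr_suml; apply: eq_bigr => i _.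
  by rewrite add0r mulrCA mulrC.
- have Dc := hs c cs; have cz : c - z != 0.
    by rewrite subr_eq0; apply: contra_not_neq Dc => ->.
  have [Lc [hLc sLc]] := pole_limits (or_intror Dc).
  rewrite -subr_eq0 (negPf cz) in sLc.
  exists (fun i => e / (c - z) * (Lc i - Lz i)); split => [i|].
    apply: tends_ext (tendsZ (e / (c - z)) (tendsB (hLc i) (hLz i))); exists 0%N => k _.
    rewrite -(root_meanB p_prime hK) // -(root_meanZ p_prime hK) //.
    apply: T_ext => x Dx xz; have xz0 : x - z != 0 by rewrite subr_eq0.
    have xc0 : x - c != 0 by apply: poles_off_neq hs Dx cs.
    by field; rewrite xz0 xc0 cz.
  under eq_bigr do rewrite mulrCA mulrBr.
  rewrite -mulr_sumr sumrB sLc sLz; have zc : z - c != 0 by rewrite -opprB oppr_eq0.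
  by field; rewrite cz zc.
- exists (fun i => L i + L' i); split => [i|].
    apply: tends_ext (tendsD (hL i) (hL' i)); exists 0%N => k _.
    rewrite -(root_meanD p_prime hK) //; congr root_mean.
    by apply/funext => x; rewrite mulrDl.
  under eq_bigr do rewrite mulrDr.
  by rewrite big_split /= sL sL' mulrDr.
Qed.

Hypothesis D_bounded : exists B, forall x, D x -> v x <= B.
Hypothesis D_closed : forall c, ~ D c ->
  exists2 k, 0 < k & forall x, D x -> k <= v (x - c).
Hypothesis wt_le1 : forall i, v (wt i) <= 1.
Hypothesis c0_le1 : v c0 <= 1.

Let K_small (e : R) : 0 < e -> exists2 t : K, t != 0 & v t < e.
Proof.
move=> e0; have [N hN] := expr_small (vabs_ge0 _) (vabs_p_lt1 p_prime (pl_p hK)) e0.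
exists (p%:R ^+ N); last by rewrite vabsX hN.
by rewrite expf_neq0 // (natr_neq0 p_prime (pl_p hK)) // prime_gt0.
Qed.

(** The means of [f] are within [e] of those of a partial fraction, uniformly in [k], hence
    converge. The identity passes to the limit because the weights and [c0] are bounded by 1. *)
Lemma family_approximable f : rat_approximable D f ->
  exists L : I -> K, (forall i, tends (fun k => T i k (fun x => f x / (x - z))) (L i)) /\
    \sum_i wt i * L i = c0 * f z.
Proof.
move=> hf.
have approx (e : R) : 0 < e -> exists s g,
    [/\ poles_off D s, partial_fraction s g, v (f z - g z) <= e &
    forall i k, v (T i k (fun x => f x / (x - z)) - T i k (fun x => g x / (x - z))) <= e].
  move=> e0; have [s [g [hs hg fg]]] := approx_partial_fraction D_bounded D_closed K_small hf e0.
  exists s, g; split => // [|i k]; first exact: fg.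
  rewrite -(root_meanB p_prime hK) //.
  have -> : (fun x => f x / (x - z) - g x / (x - z)) = (fun x => (f x - g x) / (x - z)).
    by apply/funext => x; rewrite mulrBl.
  apply: (root_mean_approx_bound p_prime p_odd hK (ab i) _ (@arcD i)) => //.
  exact: rat_approximableB hf (rat_approximable_partial_fraction hs hg).
have /choice[L hL] : forall i, exists L, tends (fun k => T i k (fun x => f x / (x - z))) L.
  move=> i; apply: tends_approx (pl_complete hK) _ => e e0.
  have [s [g [hs hg _ fg]]] := approx e e0.
  have [L [hL _]] := family_partial_fraction hs hg.
  by exists (fun k => T i k (fun x => g x / (x - z))), (L i).
exists L; split => //; apply/eqP; rewrite -subr_eq0; apply/eqP/vabs_eq0_le => e e0.
have [s [g [hs hg fgz fg]]] := approx e e0.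
have [Lg [hLg sLg]] := family_partial_fraction hs hg.
have -> : \sum_i wt i * L i - c0 * f z = \sum_i wt i * (L i - Lg i) - c0 * (f z - g z).
  under [in RHS]eq_bigr do rewrite mulrBr.
  by rewrite sumrB sLg mulrBr; ring.
have mul_le (x y : K) : v x <= 1 -> v y <= e -> v (x * y) <= e.
  by move=> hx hy; rewrite vabsM -[e]mul1r ler_pM ?vabs_ge0.
apply: vabsB_le; last exact: mul_le.
apply: vabs_sum_le => [|i _]; first exact: ltW.
by apply: mul_le => //; apply: (tends_bound (hL i) (hLg i)).
Qed.

End ArcFamily.

(** * The Cauchy formula *)

Section PathIntegral.
Context {R : realType} {C : valuedFieldType R}.
Variable p : nat.
Notation v := (@vabs R C).
Implicit Types (a b L : C) (f : C -> C) (Fam : interlocked_family).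

Lemma subseq_ge k0 (s : nat -> nat) : (forall k l, (k0 <= k)%N -> (k < l)%N -> (s k < s l)%N) ->
  forall k, (k <= s (k0 + k))%N.
Proof.
move=> hs; elim=> // k IH; apply: leq_ltn_trans IH _.
by apply: hs; rewrite ?leq_addr // addnS.
Qed.

(** Along a common subsequence supplied by interlocking, the same means approach both values. *)
Lemma is_path_integral_unique a b Fam f L L' :
  is_path_integral p a b Fam f L -> is_path_integral p a b Fam f L' -> L = L'.
Proof.
move=> h h'; apply/eqP; rewrite -subr_eq0; apply/eqP/vabs_eq0_le => e e0.
have [phi1 [K1 [m1 hK1]]] := h e e0; have [phi2 [K2 [m2 hK2]]] := h' e e0.
have [phi3 [k0 [_ _ [s1 [s1i hs1]] [s2 [s2i hs2]]]]] := members_interlocked m1 m2.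
pose k := (k0 + (K1 + K2).+1)%N; have k0k : (k0 <= k)%N by rewrite leq_addr.
have [p1 e1] := hs1 k k0k; have [p2 e2] := hs2 k k0k.
have g1 := subseq_ge s1i (K1 + K2).+1; have g2 := subseq_ge s2i (K1 + K2).+1.
have := hK1 (s1 k) p1 (leq_trans (leq_ltn_trans (leq_addr _ _) (leqnn _)) g1).
have := hK2 (s2 k) p2 (leq_trans (leq_ltn_trans (leq_addl _ _) (leqnn _)) g2).
rewrite /path_mean -e1 -e2 => h2; rewrite vabsC => h1.
exact/ltW/(vdist_lt h1).
Qed.

Lemma path_integralE a b Fam f L :
  is_path_integral p a b Fam f L -> path_integral p a b Fam f = L.
Proof.
move=> h; apply: xget_subset1 => // x y; exact: is_path_integral_unique.
Qed.

(** One $\lambda = l$ serves for every [e]. *)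
Lemma tends_is_path_integral alpha l a b f L : (0 < l)%N ->
  tends (fun k => root_mean (p ^ levels alpha l k) a b f) L ->
  is_path_integral p a b (Phi alpha%:Z) f L.
Proof.
move=> l0 h e e0; have [N hN] := h e e0.
have [phi [_ hphi]] := @Phi_set_ex alpha%:Z l 0%N l0.
exists phi, N; split => [|k hk Nk]; first by exists l.
have /eqP := hphi k hk; rewrite -PoszM -PoszD eqz_nat => /eqP E.
by rewrite /path_mean E hN // ltnW.
Qed.

End PathIntegral.

Section CauchyFormula.
Context {R : realType} {C : valuedFieldType R}.
Variable p : nat.
Hypotheses (p_prime : prime p) (p_odd : odd p) (hC : padic_like p C).
Notation v := (@vabs R C).

(** * Geometry of the domain, its holes and the disc $\mathcal{D}^*$ *)

Section Data.
Variable S : cauchy_data C.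
Notation a := (ctr S).
Notation b := (bpt S).
Notation r := (Defs.rad S).
Notation x0 := (base S).

(** The affine coordinate with value 0 at the centre and 1 at $b$, in which the outer arc is
    $D^-(1,1)$. *)
Definition boundary_coord (x : C) : C := (a - x) / (a - b).

Lemma vabs_ctr_bpt : v (a - b) = r.
Proof. by rewrite vabsC; exact: (bpt_circle S). Qed.

Let r_gt0 : 0 < r. Proof. exact: rad_gt0. Qed.

Lemma ctr_neq_bpt : a != b.
Proof. by rewrite -subr_eq0; apply: contraTneq r_gt0 => h; rewrite -vabs_ctr_bpt h vabs0 ltxx. Qed.

Lemma vabs_boundary_coordB x y : v (boundary_coord x - boundary_coord y) = v (x - y) / r.
Proof.
rewrite /boundary_coord -mulrBl vabs_div vabs_ctr_bpt [v (x - y)]vabsC; congr (v _ / _).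
by ring.
Qed.

Lemma vabs_boundary_coord x : v (boundary_coord x) = v (x - a) / r.
Proof. by rewrite /boundary_coord vabs_div vabs_ctr_bpt vabsC. Qed.

Lemma vabs_1sub_boundary_coord x : v (1 - boundary_coord x) = v (x - b) / r.
Proof.
have ab : a - b != 0 by rewrite subr_eq0 ctr_neq_bpt.
have -> : 1 - boundary_coord x = (x - b) / (a - b) by rewrite /boundary_coord; field.
by rewrite vabs_div vabs_ctr_bpt.
Qed.

Lemma hole_ctr_le i : v (hx S i - a) <= r.
Proof.
apply: (@vdist_le _ _ b); first by rewrite vabsC bpt_holes.
by rewrite vabsC vabs_ctr_bpt.
Qed.

Lemma base_ctr_le : v (x0 - a) <= r.
Proof. by have [] := base_in S. Qed.

Lemma base_hole_le i : v (x0 - hx S i) <= r.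
Proof. by apply: (vdist_le base_ctr_le); rewrite vabsC hole_ctr_le. Qed.

Lemma rstar_le i : rstar S <= v (x0 - hx S i).
Proof. exact: bigmin_le. Qed.

Lemma rstar_gt0 : 0 < rstar S.
Proof.
apply/bigmin_gtP; split => [|i _]; exact: lt_trans (hr_gt0 _) (base_holes _).
Qed.

Lemma rstar_rad : rstar S <= r.
Proof. exact: le_trans (rstar_le (Ordinal (nholes_gt0 S))) (base_hole_le _). Qed.

Lemma hole_gt i j x : i != j -> v (x - hx S i) <= hr S i -> hr S j < v (x - hx S j).
Proof.
move=> ij hi; rewrite ltNge; apply/negP => hj.
by have := holes_disjoint ij; move/seteqP => [/(_ x) h _]; apply: h.
Qed.

Lemma hole_domain i x : v (x - hx S i) = hr S i -> domain S x.
Proof.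
move=> hi; split => /=.
  by apply: (@vdist_le _ _ (hx S i)); rewrite ?hole_ctr_le // hi ltW ?hr_lt.
move=> [j _]; rewrite /hole /Dminus /=; have [<-|ij] := eqVneq i j; first by rewrite hi ltxx.
by rewrite ltNge ltW // (hole_gt ij) ?hi.
Qed.

Lemma notin_domain c : ~ domain S c -> r < v (c - a) \/ exists i, v (c - hx S i) < hr S i.
Proof.
move=> nD; have [hc|hc] := leP (v (c - a)) r; last by left.
right; have [//|h] := pselect (exists i, v (c - hx S i) < hr S i).
by exfalso; apply: nD; split => // -[i _ hi]; apply: h; exists i.
Qed.

Lemma domain_closed c : ~ domain S c ->
  exists2 k, 0 < k & forall x, domain S x -> k <= v (x - c).
Proof.
move=> /notin_domain[hc|[i hi]].
  exists r => // x [hx' _].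
  rewrite (@vdist_close _ _ _ a); rewrite [v (a - c)]vabsC; first exact: ltW.
  exact: le_lt_trans hx' hc.
exists (hr S i) => [|x [_ hx']]; first exact: hr_gt0.
have {}hx' : hr S i <= v (x - hx S i).
  by rewrite leNgt; apply/negP => h; apply: hx'; exists i.
rewrite vabsC (@vdist_close _ _ _ (hx S i)); first by rewrite vabsC.
by rewrite [X in _ < X]vabsC; apply: lt_le_trans hx'.
Qed.

Lemma domain_bounded : exists B, forall x, domain S x -> v x <= B.
Proof.
exists (Num.max r (v a)) => x [hx' _]; rewrite -(subrK a x).
by apply: vabsD_le; rewrite le_max ?lexx ?orbT //; apply/orP; left.
Qed.

Lemma Dstar_hole z i : Dstar S z -> v (z - hx S i) = v (x0 - hx S i).
Proof. by move=> hz; apply: vdist_close; apply: lt_le_trans hz (rstar_le i). Qed.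

Lemma Dstar_domain z : Dstar S z -> domain S z.
Proof.
move=> hz; split => /=.
  apply: vdist_le base_ctr_le; exact: le_trans (ltW hz) rstar_rad.
move=> [i _]; rewrite /hole /Dminus /= (Dstar_hole i hz).
by rewrite ltNge ltW // base_holes.
Qed.

Lemma Dstar_bpt z : Dstar S z -> v (z - b) = r.
Proof.
by move=> hz; rewrite (@vdist_close _ _ _ x0) base_bpt //; apply: lt_le_trans hz rstar_rad.
Qed.

Lemma hole_coord_le1 i : v (boundary_coord (hx S i)) <= 1.
Proof. by rewrite vabs_boundary_coord ler_pdivrMr // mul1r hole_ctr_le. Qed.

Lemma hole_coord_1sub i : v (1 - boundary_coord (hx S i)) = 1.
Proof. by rewrite vabs_1sub_boundary_coord vabsC bpt_holes divff // gt_eqF. Qed.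

Lemma base_coord_le1 : v (boundary_coord x0) <= 1.
Proof. by rewrite vabs_boundary_coord ler_pdivrMr // mul1r base_ctr_le. Qed.

Lemma base_coord_1sub : v (1 - boundary_coord x0) = 1.
Proof. by rewrite vabs_1sub_boundary_coord base_bpt divff // gt_eqF. Qed.

Variable alpha : nat.
Notation om := (@omega R C p).

(** [None] stands for the outer arc, [Some i] for the arc around hole [i]. *)
Definition arc_src (o : option 'I_(nholes S)) := if o is Some i then hx S i else a.
Definition arc_tgt (o : option 'I_(nholes S)) := if o is Some i then hb S i else b.
Definition arc_wt (o : option 'I_(nholes S)) : C :=
  if o is Some i then - (1 - om (boundary_coord (hx S i)) ^+ (p ^ alpha))^-1 else 1.

(** A product of individual levels fixes all the representatives, so that every integral can be
    computed along one path sequence. *)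
Lemma common_level : exists l, [/\ (0 < l)%N,
  om (boundary_coord x0) ^+ (p ^ l) = om (boundary_coord x0) &
  forall i, om (boundary_coord (hx S i)) ^+ (p ^ l) = om (boundary_coord (hx S i))].
Proof.
have [_ [l0 l0p h0]] := omegaP p_prime p_odd hC base_coord_le1.
have /choice[l hl] : forall i, exists l, (0 < l)%N /\
    om (boundary_coord (hx S i)) ^+ (p ^ l) = om (boundary_coord (hx S i)).
  by move=> i; have [_ [l lp h]] := omegaP p_prime p_odd hC (hole_coord_le1 i); exists l.
exists (l0 * \prod_i l i)%N; split => [| |i].
- by rewrite muln_gt0 l0p; apply/prodn_gt0 => i; have [] := hl i.
- exact: expp_fixed.
- rewrite (bigD1 i) //= mulnCA; apply: expp_fixed.
  by have [] := hl i.
Qed.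

(** * Limits of the means of $1/(x-w)$ over all the arcs *)

Section PoleLimits.
Variables (l : nat) (z : C).
Hypotheses (l_gt0 : (0 < l)%N) (hz : Dstar S z).
Hypothesis base_fixed : om (boundary_coord x0) ^+ (p ^ l) = om (boundary_coord x0).
Hypothesis hole_fixed :
  forall i, om (boundary_coord (hx S i)) ^+ (p ^ l) = om (boundary_coord (hx S i)).

Lemma arc_neq o : arc_src o != arc_tgt o.
Proof.
case: o => [i|]; last exact: ctr_neq_bpt.
rewrite -subr_eq0 /=; apply: contraTneq (hr_gt0 i) => h.
by rewrite -hb_hx h vabs0 ltxx.
Qed.

(** The arc at hole [i] stays on the circle bounding that hole; the outer arc stays at distance
    [rad] from every hole centre. *)
Lemma arc_domain o : padic_arc (arc_src o) (arc_tgt o) `<=` domain S.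
Proof.
case: o => [i|] x; rewrite /padic_arc /Dminus /=.
  rewrite hb_hx => h; apply: (@hole_domain i).
  by rewrite (@vdist_close _ _ _ (hb S i)) ?[v (hb S i - _)]vabsC hb_hx.
rewrite vabs_ctr_bpt => h; split => /=.
  apply: (vdist_le (ltW h)); by rewrite vabsC vabs_ctr_bpt.
move=> [j _]; rewrite /hole /Dminus /= (@vdist_close _ _ _ b) ?bpt_holes //.
by rewrite ltNge ltW // hr_lt.
Qed.

Lemma arc_Dstar o : ~ padic_arc (arc_src o) (arc_tgt o) z.
Proof.
case: o => [i|]; rewrite /padic_arc /Dminus /=; last first.
  by rewrite vabs_ctr_bpt Dstar_bpt // ltxx.
rewrite hb_hx => h; have : v (z - hx S i) <= hr S i.
  by apply: (vdist_le (ltW h)); rewrite vabsC hb_hx.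
by rewrite (Dstar_hole i hz) leNgt base_holes.
Qed.

Let T o k w := root_mean (p ^ levels alpha l k) (arc_src o) (arc_tgt o) (fun x => (x - w)^-1).

Let TE o k w : ~ padic_arc (arc_src o) (arc_tgt o) w ->
  T o k w = (1 - ((w - arc_src o) / (arc_tgt o - arc_src o)) ^+ (p ^ levels alpha l k))^-1.
Proof. by move=> hw; apply: (root_mean_pole p_prime p_odd hC (arc_neq o)). Qed.

(** The limit depends only on the residue of the coordinate of [w], so [w] may be replaced by [y],
    the base point or the centre of a hole. *)
Lemma tends_outer w y : ~ padic_arc a b w -> v (boundary_coord y) <= 1 ->
  v (1 - boundary_coord y) = 1 -> v (w - y) < r ->
  om (boundary_coord y) ^+ (p ^ l) = om (boundary_coord y) ->
  tends (fun k => T None k w) (1 - om (boundary_coord y) ^+ (p ^ alpha))^-1.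
Proof.
move=> hw y1 y1' wy fixed.
apply: tends_ext (tends_pole_in p_prime p_odd hC alpha l_gt0 y1 y1' _ fixed
  (w := boundary_coord w)).
  by exists 0%N => k _; rewrite TE //= /boundary_coord -mulrNN -invrN !opprB.
by rewrite vabs_boundary_coordB ltr_pdivrMr // mul1r.
Qed.

Lemma tends_far o w : ~ padic_arc (arc_src o) (arc_tgt o) w ->
  v (arc_src o - arc_tgt o) < v (w - arc_src o) -> tends (fun k => T o k w) 0.
Proof.
move=> hw far; have sp : 0 < v (arc_src o - arc_tgt o).
  by rewrite vabs_gt0 // subr_eq0 arc_neq.
apply: tends_ext (tends_pole_out p_prime alpha l_gt0
  (w := (w - arc_src o) / (arc_tgt o - arc_src o)) _).
  by exists 0%N => k _; rewrite TE.
by rewrite vabs_div [v (arc_tgt o - _)]vabsC ltr_pdivlMr // mul1r.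
Qed.

(** In the coordinate of the arc, [w] has absolute value less than 1, where $\omega$ is 0. *)
Lemma tends_near_hole i w : v (w - hx S i) < hr S i -> tends (fun k => T (Some i) k w) 1.
Proof.
move=> hw; have om0 : om 0 = 0.
  by rewrite /omega vabs0 eq_sym oner_eq0.
have hw' : ~ padic_arc (hx S i) (hb S i) w.
  rewrite /padic_arc /Dminus /= hb_hx => h.
  have : v (hx S i - hb S i) < hr S i by apply: vdist_lt h; rewrite vabsC.
  by rewrite hb_hx ltxx.
have pa : (p ^ alpha != 0)%N by rewrite -lt0n expn_gt0 prime_gt0.
have pl : (p ^ l != 0)%N by rewrite -lt0n expn_gt0 prime_gt0.
have -> : (1 : C) = (1 - om 0 ^+ (p ^ alpha))^-1.
  by rewrite om0 expr0n (negPf pa) subr0 invr1.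
apply: tends_ext (tends_pole_in p_prime p_odd hC alpha l_gt0 (u := 0) _ _ _ _
   (w := (w - hx S i) / (hb S i - hx S i))).
- by exists 0%N => k _; rewrite TE.
- by rewrite vabs0.
- by rewrite subr0 vabs1.
- by rewrite subr0 vabs_div [v (hb S i - _)]vabsC hb_hx ltr_pdivrMr ?hr_gt0 // mul1r.
- by rewrite om0 expr0n (negPf pl).
Qed.

(** For $w = z$ only the outer arc contributes. For $w$ outside the large disc all limits vanish.
    For $w$ in hole [i] the outer limit $1/(1 - \omega(\cdot)^{p^\alpha})$ is cancelled by arc [i],
    whose limit is 1 and whose weight is the opposite value. *)
Lemma pole_limits w : w = z \/ ~ domain S w -> exists L : option 'I_(nholes S) -> C,
  (forall o, tends (fun k => T o k w) (L o)) /\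
  \sum_o arc_wt o * L o =
    if w == z then (1 - om (boundary_coord x0) ^+ (p ^ alpha))^-1 else 0.
Proof.
move=> hw.
have warc o : ~ padic_arc (arc_src o) (arc_tgt o) w.
  by case: hw => [->|nD /arc_domain //]; apply: arc_Dstar.
have [wz|wz] := eqVneq w z.
  exists (fun o => if o is Some i then 0 else (1 - om (boundary_coord x0) ^+ (p ^ alpha))^-1).
  split; last by rewrite big_option mul1r big1 ?addr0 // => i _; rewrite mulr0.
  case=> [i|].
    apply: (tends_far (warc (Some i))); rewrite /= hb_hx wz (Dstar_hole i hz).
    exact: base_holes.
  apply: tends_outer base_fixed; rewrite ?base_coord_le1 ?base_coord_1sub //.
    exact: (warc None).
  by rewrite wz; apply: lt_le_trans hz rstar_rad.
case: hw => [/eqP|nD]; first by rewrite (negPf wz).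
case: (notin_domain nD) => [far|[i hi]].
  exists (fun=> 0); split; last by rewrite big1 // => o _; rewrite mulr0.
  case=> [i|]; apply: (tends_far (warc _)); rewrite /= ?vabs_ctr_bpt //.
  rewrite hb_hx vabsC (@vdist_close _ _ _ a).
    by rewrite vabsC; apply: lt_trans far; apply: hr_lt.
  by rewrite [v (a - w)]vabsC; apply: le_lt_trans far; apply: hole_ctr_le.
exists (fun o => if o is Some j then (j == i)%:R
                 else (1 - om (boundary_coord (hx S i)) ^+ (p ^ alpha))^-1).
split; last first.
  rewrite big_option mul1r (bigD1 i) //= eqxx mulr1 big1 ?addr0 ?subrr // => j /negPf ->.
  by rewrite mulr0.
case=> [j|]; last first.
  apply: tends_outer (hole_fixed i); rewrite ?hole_coord_le1 ?hole_coord_1sub //.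
    exact: (warc None).
  exact: lt_trans hi (hr_lt i).
have [->|ji] := eqVneq j i; first exact: tends_near_hole.
by apply: (tends_far (warc (Some j))); rewrite /= hb_hx (@hole_gt i) ?ltW // eq_sym.
Qed.

End PoleLimits.

Lemma cauchy_formula z f : Dstar S z -> krasner_analytic (domain S) f ->
  let g := fun x : C => f x / (x - z) in
  [/\ path_integrable p a b (Phi alpha%:Z) g,
      (forall i, path_integrable p (hx S i) (hb S i) (Phi alpha%:Z) g)
    & f z / (1 - om (boundary_coord x0) ^+ (p ^ alpha)%N)
      = path_integral p a b (Phi alpha%:Z) g
        - \sum_(i < nholes S) 1 / (1 - om (boundary_coord (hx S i)) ^+ (p ^ alpha)%N)
            * path_integral p (hx S i) (hb S i) (Phi alpha%:Z) g].
Proof.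
move=> hz hf g; have [l [l0 fix0 fixh]] := common_level.
have hfa : rat_approximable (domain S) f.
  apply: krasner_rat_approximable (pl_closed hC) _ hf.
  by exists z; apply: Dstar_domain.
(* As $b$ is at distance [rad] from the hole centres and from the base point, all the denominators
   have absolute value 1. *)
have wt1 o : v (arc_wt o) <= 1.
  case: o => [i|]; last by rewrite vabs1.
  by rewrite vabsN vabsV (vabs_1sub_omega p_prime p_odd hC) ?invr1 ?hole_coord_le1 ?hole_coord_1sub.
have c1 : v (1 - om (boundary_coord x0) ^+ (p ^ alpha))^-1 <= 1.
  by rewrite vabsV (vabs_1sub_omega p_prime p_odd hC) ?invr1 ?base_coord_le1 ?base_coord_1sub.
have [L [hL sL]] := family_approximable p_prime p_odd hC l0 arc_neq arc_domain
  (arc_Dstar hz) (Dstar_domain hz) (pole_limits l0 hz fix0 fixh) domain_bounded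
  domain_closed wt1 c1 hfa.
have intN := tends_is_path_integral l0 (hL None).
have intS i := tends_is_path_integral l0 (hL (Some i)).
split; [by exists (L None)|by move=> i; exists (L (Some i)); exact: intS|].
rewrite (path_integralE intN) mulrC -sL big_option mul1r; congr (_ + _).
rewrite -sumrN; apply: eq_bigr => i _.
by rewrite (path_integralE (intS i)) mulNr div1r.
Qed.

End Data.

(** * Dependence of the coefficients on the sets alone *)

Lemma arc_rad_le (S S' : cauchy_data C) :
  padic_arc (ctr S) (bpt S) = padic_arc (ctr S') (bpt S') -> Defs.rad S <= Defs.rad S'.
Proof.
rewrite /padic_arc !vabs_ctr_bpt => h; rewrite leNgt; apply/negP => rr.
have hb : Dminus (bpt S') (Defs.rad S') (bpt S).
  by rewrite -h /Dminus /= subrr vabs0 rad_gt0.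
(* With a larger first radius, the centre of [S'] would lie in the common arc, although its distance
   from [bpt S'] is exactly the radius. *)
have : Dminus (bpt S) (Defs.rad S) (ctr S').
  apply: le_lt_trans rr; apply: (@vdist_le _ _ (bpt S')); first by rewrite vabs_ctr_bpt.
  by rewrite vabsC ltW.
by rewrite h /Dminus /= vabs_ctr_bpt ltxx.
Qed.

(* If the radii differed, the point [hb] on the boundary of the smaller disc would
   lie in the larger one; but it belongs to the domain. *)
Lemma hole_match (S S' : cauchy_data C) : domain S = domain S' ->
  Defs.rad S = Defs.rad S' -> v (ctr S - ctr S') <= Defs.rad S ->
  forall i, exists j, v (hx S i - hx S' j) < hr S i /\ hr S i = hr S' j.
Proof.
move=> hD rr haa i.
have nD : ~ domain S' (hx S i).
  by rewrite -hD => -[_]; apply; exists i; rewrite /hole /Dminus //= subrr vabs0 hr_gt0.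
have inD (T : cauchy_data C) j x : v (x - hx T j) < hr T j -> ~ domain T x.
  by move=> h [_]; apply; exists j.
case: (notin_domain nD) => [|[j hj]].
  by rewrite -rr ltNge (vdist_le (hole_ctr_le i) haa).
have ri : v (hb S i - hx S i) = hr S i by rewrite vabsC hb_hx.
have rj : v (hb S' j - hx S' j) = hr S' j by rewrite vabsC hb_hx.
exists j; case: (ltgtP (hr S i) (hr S' j)) => [lt_ij|lt_ji|e]; last by rewrite e.
  exfalso; apply: (inD S' j (hb S i)).
    by apply: vdist_lt hj; rewrite ri.
  by rewrite -hD; apply: hole_domain ri.
exfalso; apply: (inD S i (hb S' j)); last by rewrite hD; apply: hole_domain rj.
by apply: le_lt_trans lt_ji; rewrite (@vdist_le _ _ (hx S' j)) ?rj // vabsC ltW.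
Qed.

(** The centre [hx S' (s i)] lies in hole [i] of [S], and the holes are disjoint. *)
Lemma hole_match_inj (S S' : cauchy_data C) (s : 'I_(nholes S) -> 'I_(nholes S')) :
  (forall i, v (hx S i - hx S' (s i)) < hr S i) -> injective s.
Proof.
move=> hs i j ij; apply/eqP; apply: contraT => nij.
have := hole_gt nij (x := hx S' (s i)); rewrite {2}ij vabsC ltW // => /(_ isT).
by rewrite ltNge ltW // vabsC.
Qed.

(** Moving the centre, $b$ and the point by less than [rad] moves the coordinate by less than 1,
    which $\omega$ does not see. *)
Lemma omega_boundary_coord (S S' : cauchy_data C) y y' :
  Defs.rad S = Defs.rad S' -> v (ctr S - ctr S') < Defs.rad S ->
  v (bpt S - bpt S') < Defs.rad S -> v (y - y') < Defs.rad S ->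
  v (y - ctr S) <= Defs.rad S ->
  omega p (boundary_coord S' y') = omega p (boundary_coord S y).
Proof.
move=> rr haa hbb hyy hy; have r0 := rad_gt0 S.
apply: (omega_close p_prime p_odd hC).
  by rewrite vabs_boundary_coord ler_pdivrMr // mul1r.
have d0 : ctr S - bpt S != 0 by rewrite subr_eq0 ctr_neq_bpt.
have d'0 : ctr S' - bpt S' != 0 by rewrite subr_eq0 ctr_neq_bpt.
have -> : boundary_coord S' y' - boundary_coord S y =
   ((ctr S' - y') - (ctr S - y)) / (ctr S' - bpt S') +
   boundary_coord S y * (((ctr S - bpt S) - (ctr S' - bpt S')) / (ctr S' - bpt S')).
  by rewrite /boundary_coord; field; rewrite d0 d'0.
apply: vabsD_lt.
  rewrite vabs_div vabs_ctr_bpt -rr ltr_pdivrMr // mul1r.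
  have -> : ctr S' - y' - (ctr S - y) = (y - y') - (ctr S - ctr S') by ring.
  exact: vabsB_lt.
rewrite vabsM vabs_boundary_coord.
apply: (@le_lt_trans _ _ (v ((ctr S - bpt S - (ctr S' - bpt S')) / (ctr S' - bpt S')))).
  by rewrite ler_piMl ?vabs_ge0 // ler_pdivrMr // mul1r.
rewrite vabs_div vabs_ctr_bpt -rr ltr_pdivrMr // mul1r.
have -> : ctr S - bpt S - (ctr S' - bpt S') = (ctr S - ctr S') - (bpt S - bpt S') by ring.
exact: vabsB_lt.
Qed.

Lemma coefficients_independent (S S' : cauchy_data C) :
  padic_arc (ctr S) (bpt S) = padic_arc (ctr S') (bpt S') ->
  Dstar S = Dstar S' -> domain S = domain S' -> boundary S = boundary S' ->
  omega p (boundary_coord S' (base S')) = omega p (boundary_coord S (base S)) /\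
  exists s : 'I_(nholes S) -> 'I_(nholes S'), bijective s /\
    forall i, hole S i = hole S' (s i) /\
      omega p (boundary_coord S' (hx S' (s i))) = omega p (boundary_coord S (hx S i)).
Proof.
move=> harc hstar hD hbd.
have rr : Defs.rad S = Defs.rad S' by apply/le_anti; rewrite !arc_rad_le.
have hbb : v (bpt S - bpt S') < Defs.rad S.
  have : padic_arc (ctr S') (bpt S') (bpt S).
    by rewrite -harc /padic_arc /Dminus /= subrr vabs0 vabs_ctr_bpt rad_gt0.
  by rewrite /padic_arc /Dminus /= vabs_ctr_bpt rr.
have haa : v (ctr S - ctr S') < Defs.rad S.
  have hb : v (bpt S - ctr S') = Defs.rad S.
    have : boundary S' (bpt S) by rewrite -hbd; apply: bpt_circle.
    by rewrite /boundary /circle /= rr.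
  (* Both centres are at distance [rad] from [bpt S]. Were they also at distance [rad] from each
     other, [ctr S] would lie on the common boundary circle, of which it is the centre. *)
  rewrite lt_neqAle; apply/andP; split.
    apply/eqP => h; have : boundary S (ctr S) by rewrite hbd /boundary /circle /= -rr.
    rewrite /boundary /circle /= subrr vabs0 => h0.
    by have := rad_gt0 S; rewrite -h0 ltxx.
  by apply: (@vdist_le _ _ (bpt S)); rewrite ?vabs_ctr_bpt ?hb.
have hxx : v (base S - base S') < Defs.rad S.
  have : Dstar S (base S') by rewrite hstar /Dstar /Dminus /= subrr vabs0 rstar_gt0.
  by rewrite /Dstar /Dminus /= vabsC => h; apply: lt_le_trans h (rstar_rad S).
split; first exact: omega_boundary_coord (base_ctr_le S).
have /choice[s hs] := hole_match hD rr (ltW haa).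
have haa' : v (ctr S' - ctr S) <= Defs.rad S' by rewrite vabsC -rr ltW.
have /choice[s' hs'] := hole_match (esym hD) (esym rr) haa'.
exists s; split.
  (* Matching the holes in both directions gives injections both ways between finite sets. *)
  apply: inj_card_bij; first by apply: hole_match_inj => i; case: (hs i).
  by apply: (leq_card s'); apply: hole_match_inj => i; case: (hs' i).
move=> i; have [hi ri] := hs i; split.
  apply/seteqP; split => x; rewrite /hole /Dminus /= -ri => h; apply: vdist_lt h _ => //.
  by rewrite vabsC.
apply: omega_boundary_coord => //; last exact: hole_ctr_le.
exact: lt_trans hi (hr_lt i).
Qed.

End CauchyFormula.

Theorem theorem6p10 (R : realType) (p : nat) (p_prime : prime p)
    (p_odd : odd p) (C : valuedFieldType R) (C_Cp : is_padic_complex p C) :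
  (forall (S : cauchy_data C) (alpha : nat) (z : C) (f : C -> C),
     Dstar S z -> krasner_analytic (domain S) f ->
     let g := fun x : C => f x / (x - z) in
     [/\ path_integrable p (ctr S) (bpt S) (Phi alpha%:Z) g,
         (forall i, path_integrable p (hx S i) (hb S i) (Phi alpha%:Z) g)
       & f z / (1 - omega p ((ctr S - base S) / (ctr S - bpt S))
                      ^+ (p ^ alpha)%N)
         = path_integral p (ctr S) (bpt S) (Phi alpha%:Z) g
           - \sum_(i < nholes S)
               1 / (1 - omega p ((ctr S - hx S i) / (ctr S - bpt S))
                          ^+ (p ^ alpha)%N)
               * path_integral p (hx S i) (hb S i) (Phi alpha%:Z) g])
  /\
  (* the constant coefficients depend only on the indicated sets *)
  (forall (S S' : cauchy_data C) (alpha : nat),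
     padic_arc (ctr S) (bpt S) = padic_arc (ctr S') (bpt S') ->
     Dstar S = Dstar S' -> domain S = domain S' -> boundary S = boundary S' ->
     1 / (1 - omega p ((ctr S - base S) / (ctr S - bpt S)) ^+ (p ^ alpha)%N)
     = 1 / (1 - omega p ((ctr S' - base S') / (ctr S' - bpt S'))
                  ^+ (p ^ alpha)%N)
     /\
     exists s : 'I_(nholes S) -> 'I_(nholes S'), bijective s /\
       forall i, hole S i = hole S' (s i) /\
         1 / (1 - omega p ((ctr S - hx S i) / (ctr S - bpt S))
                    ^+ (p ^ alpha)%N)
         = 1 / (1 - omega p ((ctr S' - hx S' (s i)) / (ctr S' - bpt S'))
                      ^+ (p ^ alpha)%N)).
Proof.
have hC := padic_complex_like p_prime C_Cp; split => [S alpha z f hz hf|S S' alpha h1 h2 h3 h4].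
  exact: (cauchy_formula p_prime p_odd hC alpha hz hf).
have [e [s [bs hs]]] := coefficients_independent p_prime p_odd hC h1 h2 h3 h4.
rewrite -!/(boundary_coord _ _) e; split=> //; exists s; split=> // i.
by have [-> ei] := hs i; rewrite -!/(boundary_coord _ _) ei.
Qed.
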